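(* Let $q>7$. In $\mathrm{PG}(2,q^2)$ let $\mathcal B$ be a Baer subplane tangent to $\ell_\infty$, and $\mathcal C$ an $\mathbb F_q$-conic in $\mathcal B$ with $\mathcal B\cap\ell_\infty\notin\mathcal C$, so that $[\mathcal C]$ is a $4$-dimensional normal rational curve of $\mathrm{PG}(4,q)$. Let the $\mathbb F_{q^2}$-conic $\mathcal C^+$ meet (the extension to $\mathrm{PG}(2,q^4)$ of) $\ell_\infty$ in the two points $\bar P,\bar Q$, possibly equal or lying in $\mathrm{PG}(2,q^4)\setminus\mathrm{PG}(2,q^2)$. Then: (1) $\bar P=\bar Q$ (i.e. $\mathcal C^+$ is tangent to $\ell_\infty$ at $\bar P$) if and only if $[\mathcal C]^\star$ meets $g$ in the single point $P$ (with multiplicity two); (2) $\bar P\neq\bar Q$ with $\bar P,\bar Q\in\ell_\infty$ if and only if $[\mathcal C]^\star$ meets $g$ in the two points $P,Q$; (3) $\bar P,\bar Q$ lie in $\mathrm{PG}(2,q^4)\setminus\mathrm{PG}(2,q^2)$ if and only if in $\mathrm{PG}(4,q^4)$, $[\mathcal C]^{\star\star}$ meets $g^{\star\star}$ in the two points $P,Q$.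
   Context: Coordinates: $\tau$ is a primitive element of $\mathbb F_{q^2}$ with minimal polynomial $x^2-t_1x-t_0$ over $\mathbb F_q$; $\ell_\infty: z=0$ in $\mathrm{PG}(2,q^2)$; $\Sigma_\infty: z=0$ in $\mathrm{PG}(4,q)$ with coordinates $(x_0,x_1,y_0,y_1,z)$. The Bruck–Bose map sends the affine point $X=(x_0+x_1\tau,y_0+y_1\tau,1)$ to $[X]=(x_0,x_1,y_0,y_1,1)$ and $\bar T=(\delta,1,0)$, $\delta=d_0+d_1\tau$, to the spread line $[T]=\langle(d_0,d_1,1,0,0),(t_0d_1,d_0+t_1d_1,0,1,0)\rangle$ of the regular spread $\mathcal S$ of $\Sigma_\infty$. With $A_0=(\tau^q,-1,0,0,0)$, $A_1=(0,0,\tau^q,-1,0)$, the transversals are $g=\langle A_0,A_1\rangle$ and $g^q$ in $\mathrm{PG}(4,q^2)$; $g^{\star\star}$ is the extension of $g$ to $\mathrm{PG}(4,q^4)$. For $\alpha\in\mathbb F_{q^4}\cup\{\infty\}$, the point $\bar P=(\alpha,1,0)$ of the extension of $\ell_\infty$ to $\mathrm{PG}(2,q^4)$ corresponds to $P=\alpha A_0+A_1\in g^{\star\star}$ ($P=A_0$ if $\alpha=\infty$). An $\mathbb F_q$-conic is a non-degenerate conic of a Baer subplane; $\mathcal C^+$ is the unique non-degenerate conic of $\mathrm{PG}(2,q^2)$ containing $\mathcal C$. $[\mathcal C]=\{[X]:X\in\mathcal C\}$, and $[\mathcal C]^\star$, $[\mathcal C]^{\star\star}$ are the extensions of this normal rational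 curve to $\mathrm{PG}(4,q^2)$, $\mathrm{PG}(4,q^4)$ (parameter ranging over the larger field).
   Formalization: In (3) the right-hand side also requires that [C]^⋆ and g have no common point in PG(4,q^2) and that P≠Q; without this, [C]^{⋆⋆} also meets g^{⋆⋆} in the two points P,Q in case (2), and the stated equivalence fails. *)

(* Defs.v *)
(* All objects live in one finite field K with |K| = q^4,
   i.e. K = F_{q^4}; F_q and F_{q^2} are its subfields (fixed points of
   x |-> x^q resp. x |-> x^(q^2)). Projective points are nonzero column
   vectors up to nonzero scalars of K. *)
From HB Require Import structures.
From mathcomp Require Import all_boot all_order all_algebra all_field.
Set Implicit Arguments. Unset Strict Implicit. Unset Printing Implicit Defensive.
Import GRing.Theory.
Local Open Scope ring_scope.

Section Defs.
Variable K : finFieldType.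

Definition Fsub (m : nat) : pred K := fun x => x ^+ m == x.

Definition c3_0 : 'I_3 := @Ordinal 3 0 isT.
Definition c3_1 : 'I_3 := @Ordinal 3 1 isT.
Definition c3_2 : 'I_3 := @Ordinal 3 2 isT.

Definition vec3 (a b c : K) : 'cV[K]_3 := \col_(i < 3) [:: a; b; c]`_i.
Definition vec5 (a b c d e : K) : 'cV[K]_5 := \col_(i < 5) [:: a; b; c; d; e]`_i.

Definition vover (S : pred K) n (v : 'cV[K]_n) : Prop := forall i, S (v i ord0).
Definition rover (S : pred K) n (v : 'rV[K]_n) : Prop := forall i, S (v ord0 i).
Definition mover (S : pred K) m n (A : 'M[K]_(m, n)) : Prop := forall i j, S (A i j).

Definition peq n (u v : 'cV[K]_n) : Prop :=
  u != 0 /\ exists2 c : K, c != 0 & v = c *: u.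

Definition peq2 (u v : K * K) : Prop :=
  u != (0, 0) /\ exists2 c : K, c != 0 & v = (c * u.1, c * u.2).

Definition pt2over (S : pred K) (u : K * K) : Prop :=
  u != (0, 0) /\ exists2 c : K, c != 0 & S (c * u.1) /\ S (c * u.2).

(* Baer subplane M(PG(2,q)), M in GL(3,q^2): point v belongs to it *)
Definition in_B (q : nat) (M : 'M[K]_3) (v : 'cV[K]_3) : Prop :=
  exists w : 'cV[K]_3, [/\ vover (Fsub q) w, w != 0 & peq (M *m w) v].

Definition qf (A : 'M[K]_3) (w : 'cV[K]_3) : K := (w^T *m A *m w) ord0 ord0.

(* Hirschfeld's discriminant of the conic a x^2 + b y^2 + c z^2 + f yz + g zx + h xy;
   the conic is non-degenerate iff it is nonzero (any characteristic) *)
Definition qdisc (A : 'M[K]_3) : K :=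
  let a := A c3_0 c3_0 in let b := A c3_1 c3_1 in let c := A c3_2 c3_2 in
  let f := A c3_1 c3_2 + A c3_2 c3_1 in
  let g := A c3_0 c3_2 + A c3_2 c3_0 in
  let h := A c3_0 c3_1 + A c3_1 c3_0 in
  4%:R * a * b * c - a * f ^+ 2 - b * g ^+ 2 - c * h ^+ 2 + f * g * h.

(* the F_q-conic of the Baer subplane M(PG(2,q)) which is the image under M
   of the conic {w in PG(2,q) | w^T A w = 0} of PG(2,q) *)
Definition in_C (q : nat) (M A : 'M[K]_3) (v : 'cV[K]_3) : Prop :=
  exists w : 'cV[K]_3,
    [/\ vover (Fsub q) w, w != 0, qf A w = 0 & peq (M *m w) v].

(* u = [X] where X = v = (x0 + x1 tau, y0 + y1 tau, 1) is an affine point *)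
Definition bb_rel (q : nat) (tau : K) (u : 'cV[K]_5) (v : 'cV[K]_3) : Prop :=
  exists x0 x1 y0 y1 : K,
    [/\ [/\ Fsub q x0, Fsub q x1, Fsub q y0 & Fsub q y1],
        peq (vec3 (x0 + x1 * tau) (y0 + y1 * tau) 1) v &
        peq (vec5 x0 x1 y0 y1 1) u].

Definition in_bbC (q : nat) (tau : K) (M A : 'M[K]_3) (u : 'cV[K]_5) : Prop :=
  exists v, in_C q M A v /\ bb_rel q tau u v.

Definition nu (t0 t1 : K) : 'cV[K]_5 :=
  vec5 (t0 ^+ 4) (t0 ^+ 3 * t1) (t0 ^+ 2 * t1 ^+ 2) (t0 * t1 ^+ 3) (t1 ^+ 4).

(* u is on the curve { N nu(t) : t in PG(1,S) }; with N over F_q this is a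
   4-dim normal rational curve of PG(4,q) for S = F_q, and its extensions
   to PG(4,q^2), PG(4,q^4) for S = F_{q^2}, S = predT (= F_{q^4}) *)
Definition on_nrc (S : pred K) (N : 'M[K]_5) (u : 'cV[K]_5) : Prop :=
  exists t0 t1 : K, [/\ S t0, S t1, (t0, t1) != (0, 0) & peq (N *m nu t0 t1) u].

Definition A0 (q : nat) (tau : K) : 'cV[K]_5 := vec5 (tau ^+ q) (-1) 0 0 0.
Definition A1 (q : nat) (tau : K) : 'cV[K]_5 := vec5 0 0 (tau ^+ q) (-1) 0.

(* u is a point of g (S = F_{q^2}) resp. of g** (S = predT) *)
Definition on_g (S : pred K) (q : nat) (tau : K) (u : 'cV[K]_5) : Prop :=
  exists a b : K, [/\ S a, S b & peq (a *: A0 q tau + b *: A1 q tau) u].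

(* the point P = a A0 + b A1 of g** corresponding to Pbar = (a, b, 0) *)
Definition gpt (q : nat) (tau : K) (p : K * K) : 'cV[K]_5 :=
  p.1 *: A0 q tau + p.2 *: A1 q tau.

(* dehomogenisation f(t) = F(t,1) of the binary quartic F(X,Y) = l . N nu(X,Y) *)
Definition bform (l : 'rV[K]_5) (N : 'M[K]_5) : {poly K} :=
  \poly_(i < 5) (l *m N) ord0 (inord (4 - i)).

(* multiplicity of (t0 : t1) as a root of the binary quartic with
   dehomogenisation f *)
Definition bmult (f : {poly K}) (t0 t1 : K) : nat :=
  if t1 == 0 then (4 - (size f).-1)%N else mup (t0 / t1) f.

(* intersection multiplicity of the curve N nu with the line g at the
   parameter (t0 : t1): the least vanishing order at (t0 : t1) of the
   restriction to the curve of a hyperplane (over F_{q^2}) containing g *)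
Definition imult_is (q : nat) (tau : K) (N : 'M[K]_5) (t0 t1 : K) (m : nat) : Prop :=
  (exists l : 'rV[K]_5,
     [/\ rover (Fsub (q ^ 2)) l, l *m A0 q tau = 0, l *m A1 q tau = 0,
         bform l N != 0 & bmult (bform l N) t0 t1 = m]) /\
  (forall l : 'rV[K]_5, rover (Fsub (q ^ 2)) l ->
     l *m A0 q tau = 0 -> l *m A1 q tau = 0 -> bform l N != 0 ->
     (m <= bmult (bform l N) t0 t1)%N).

End Defs.

(* Main.v *)
(* Choose a parametrization G nu2(t) = (x, y, z)(t) of C by quadratic forms, and
   write x', y', z' for the forms with conjugate coefficients. In the coordinates
   x0 + x1 tau, x0 + x1 tau^q, y0 + y1 tau, y0 + y1 tau^q, z of PG(4, q^2) the
   curve [C] is (x z', x' z, y z', y' z, z z'). If G matches the given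
   parametrization N nu(t) of [C] at t = (1 : 0), (0 : 1), (1 : 1), then this
   vector is proportional to N nu(t) identically: all quadrics through the
   standard normal rational curve vanish at the q + 1 > 8 rational parameters, so
   they vanish identically, and the only rational normal quartics satisfying
   this and fixing three points are the trivial ones.
   In these coordinates the hyperplanes containing g are spanned by the second,
   fourth and fifth coordinate; they cut [C] in z times an arbitrary quadratic
   form. So [C] meets g exactly where z = 0, with the multiplicity of that root
   of z, and the point there is x A0 + y A1. Since G nu2(t) also parametrizes
   C+, these are the points P and Q. *)
Require Import Defs.
From HB Require Import structures.
From mathcomp Require Import all_boot all_order all_fingroup all_algebra all_solvable all_field.
From mathcomp Require Import ring zify.
Import GRing.Theory.
Local Open Scope ring_scope.

(** * Coordinate vectors, projective equality and binary forms *)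

Section Coordinates.
Set Implicit Arguments. Unset Strict Implicit.
Context {K : finFieldType}.
Implicit Types (c t : K) (a b : 'rV[K]_3).

Definition c5_0 : 'I_5 := @Ordinal 5 0 isT.
Definition c5_1 : 'I_5 := @Ordinal 5 1 isT.
Definition c5_2 : 'I_5 := @Ordinal 5 2 isT.
Definition c5_3 : 'I_5 := @Ordinal 5 3 isT.
Definition c5_4 : 'I_5 := @Ordinal 5 4 isT.

Lemma ord3P (P : 'I_3 -> Prop) : P c3_0 -> P c3_1 -> P c3_2 -> forall i, P i.
Proof.
move=> P0 P1 P2 [[|[|[|//]]] lti].
- by rewrite (_ : Ordinal lti = c3_0) //; apply: val_inj.
- by rewrite (_ : Ordinal lti = c3_1) //; apply: val_inj.
- by rewrite (_ : Ordinal lti = c3_2) //; apply: val_inj.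
Qed.

Lemma ord5P (P : 'I_5 -> Prop) :
  P c5_0 -> P c5_1 -> P c5_2 -> P c5_3 -> P c5_4 -> forall i, P i.
Proof.
move=> P0 P1 P2 P3 P4 [[|[|[|[|[|//]]]]] lti].
- by rewrite (_ : Ordinal lti = c5_0) //; apply: val_inj.
- by rewrite (_ : Ordinal lti = c5_1) //; apply: val_inj.
- by rewrite (_ : Ordinal lti = c5_2) //; apply: val_inj.
- by rewrite (_ : Ordinal lti = c5_3) //; apply: val_inj.
- by rewrite (_ : Ordinal lti = c5_4) //; apply: val_inj.
Qed.

Lemma sum3E (V : nmodType) (F : 'I_3 -> V) : \sum_i F i = F c3_0 + F c3_1 + F c3_2.
Proof.
rewrite !big_ord_recl big_ord0 addr0 addrA.
by congr (F _ + F _ + F _); apply: val_inj.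
Qed.

Lemma sum5E (V : nmodType) (F : 'I_5 -> V) :
  \sum_i F i = F c5_0 + F c5_1 + F c5_2 + F c5_3 + F c5_4.
Proof.
rewrite !big_ord_recl big_ord0 addr0 !addrA.
by congr (F _ + F _ + F _ + F _ + F _); apply: val_inj.
Qed.

Lemma vec3P (u v : 'cV[K]_3) :
  u c3_0 ord0 = v c3_0 ord0 -> u c3_1 ord0 = v c3_1 ord0 ->
  u c3_2 ord0 = v c3_2 ord0 -> u = v.
Proof. by move=> *; apply/colP; apply: ord3P. Qed.

Lemma vec5P (u v : 'cV[K]_5) :
  u c5_0 ord0 = v c5_0 ord0 -> u c5_1 ord0 = v c5_1 ord0 ->
  u c5_2 ord0 = v c5_2 ord0 -> u c5_3 ord0 = v c5_3 ord0 ->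
  u c5_4 ord0 = v c5_4 ord0 -> u = v.
Proof. by move=> *; apply/colP; apply: ord5P. Qed.

Lemma scale_vec5 k (a b c d e : K) :
  k *: vec5 a b c d e = vec5 (k * a) (k * b) (k * c) (k * d) (k * e).
Proof. by apply: vec5P; rewrite !mxE. Qed.

Lemma vec5_inj (a b c d e a' b' c' d' e' : K) :
  vec5 a b c d e = vec5 a' b' c' d' e' -> [/\ a = a', b = b', c = c', d = d' & e = e'].
Proof.
move/colP => v; split;
  [have := v c5_0|have := v c5_1|have := v c5_2|have := v c5_3|have := v c5_4]; by rewrite !mxE.
Qed.

Lemma rvec5P (u v : 'rV[K]_5) :
  u ord0 c5_0 = v ord0 c5_0 -> u ord0 c5_1 = v ord0 c5_1 ->
  u ord0 c5_2 = v ord0 c5_2 -> u ord0 c5_3 = v ord0 c5_3 ->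
  u ord0 c5_4 = v ord0 c5_4 -> u = v.
Proof. by move=> *; apply/rowP; apply: ord5P. Qed.

Lemma peq_trans n (u v w : 'cV[K]_n) : peq u v -> peq v w -> peq u w.
Proof.
move=> [u0 [c c0 ->]] [_ [d d0 ->]]; split=> //.
by exists (d * c); rewrite ?mulf_neq0 // scalerA.
Qed.

Lemma peq_sym n (u v : 'cV[K]_n) : peq u v -> peq v u.
Proof.
move=> [u0 [c c0 ->]]; split; first by rewrite scaler_eq0 negb_or c0.
by exists c^-1; rewrite ?invr_eq0 // scalerA mulVf // scale1r.
Qed.

Lemma peqZ n (u : 'cV[K]_n) c : u != 0 -> c != 0 -> peq u (c *: u).
Proof. by split=> //; exists c. Qed.

Lemma peq_refl n (u : 'cV[K]_n) : u != 0 -> peq u u.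
Proof. by move=> u0; rewrite -{2}[u]scale1r; apply: peqZ; rewrite ?oner_neq0. Qed.

Lemma mulmx_unit_eq0 n (A : 'M[K]_n) (u : 'cV[K]_n) :
  A \in unitmx -> (A *m u == 0) = (u == 0).
Proof.
move=> Au; apply/eqP/eqP => [Au0|->]; last by rewrite mulmx0.
by rewrite -[u](mulKmx Au) Au0 mulmx0.
Qed.

Lemma peq_mulmx n (A : 'M[K]_n) (u v : 'cV[K]_n) :
  A \in unitmx -> peq u v -> peq (A *m u) (A *m v).
Proof.
move=> Au [u0 [c c0 ->]]; rewrite -scalemxAr; apply: peqZ => //.
by rewrite mulmx_unit_eq0.
Qed.

Lemma peq_mulmxI n (A : 'M[K]_n) (u v : 'cV[K]_n) :
  A \in unitmx -> peq (A *m u) (A *m v) -> peq u v.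
Proof.
move=> Au [u0 [c c0 e]]; rewrite mulmx_unit_eq0 // in u0; split=> //; exists c => //.
by rewrite -[v](mulKmx Au) e -scalemxAr mulKmx.
Qed.

Definition nu2 t0 t1 : 'cV[K]_3 := vec3 (t0 ^+ 2) (t0 * t1) (t1 ^+ 2).

Lemma nu_eq0 t0 t1 : (nu t0 t1 == 0) = ((t0, t1) == (0, 0)).
Proof.
apply/eqP/eqP => [/colP e|[-> ->]].
  have := e c5_0; have := e c5_4; rewrite !mxE /= => /eqP + /eqP.
  by rewrite !expf_eq0 /= => /eqP-> /eqP->.
by apply: vec5P; rewrite !mxE /= ?expr0n /= ?mul0r ?mulr0.
Qed.

Lemma nu2_eq0 t0 t1 : (nu2 t0 t1 == 0) = ((t0, t1) == (0, 0)).
Proof.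
apply/eqP/eqP => [/colP e|[-> ->]].
  have := e c3_0; have := e c3_2; rewrite !mxE /= => /eqP + /eqP.
  by rewrite !expf_eq0 /= => /eqP-> /eqP->.
by apply: vec3P; rewrite !mxE /= ?expr0n /= ?mul0r ?mulr0.
Qed.

Lemma row3E (a : 'rV[K]_3) (u : 'cV[K]_3) i j : (a *m u) i j =
  a ord0 c3_0 * u c3_0 ord0 + a ord0 c3_1 * u c3_1 ord0 + a ord0 c3_2 * u c3_2 ord0.
Proof. by rewrite !ord1 mxE sum3E. Qed.

Lemma row5E (a : 'rV[K]_5) (u : 'cV[K]_5) i j : (a *m u) i j =
  a ord0 c5_0 * u c5_0 ord0 + a ord0 c5_1 * u c5_1 ord0 + a ord0 c5_2 * u c5_2 ord0
  + a ord0 c5_3 * u c5_3 ord0 + a ord0 c5_4 * u c5_4 ord0.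
Proof. by rewrite !ord1 mxE sum5E. Qed.

(** Multiplication of binary quadratic forms on coefficient rows; the product is a quartic form in
    the monomials of [nu]. *)
Definition conv (a b : 'rV[K]_3) : 'rV[K]_5 :=
  \row_j [:: a ord0 c3_0 * b ord0 c3_0;
             a ord0 c3_0 * b ord0 c3_1 + a ord0 c3_1 * b ord0 c3_0;
             a ord0 c3_0 * b ord0 c3_2 + a ord0 c3_1 * b ord0 c3_1
               + a ord0 c3_2 * b ord0 c3_0;
             a ord0 c3_1 * b ord0 c3_2 + a ord0 c3_2 * b ord0 c3_1;
             a ord0 c3_2 * b ord0 c3_2]`_j.

Lemma conv_nu a b t0 t1 i j :
  (conv a b *m nu t0 t1) i j = (a *m nu2 t0 t1) i j * (b *m nu2 t0 t1) i j.
Proof. by rewrite row5E !row3E !mxE /=; ring. Qed.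

(** The index is reversed because [nu] starts with the highest power of [t0]. [bform l N] unfolds to
    [quartic (l *m N)]. *)
Definition quartic (r : 'rV[K]_5) : {poly K} := \poly_(i < 5) r ord0 (inord (4 - i)).

Lemma quarticE r : quartic r = (r ord0 c5_0)%:P * 'X^4 + (r ord0 c5_1)%:P * 'X^3
  + (r ord0 c5_2)%:P * 'X^2 + (r ord0 c5_3)%:P * 'X + (r ord0 c5_4)%:P.
Proof.
rewrite /quartic poly_def sum5E /= -!mul_polyC expr0 mulr1 expr1.
have e (i : 'I_5) : inord i = i by apply: val_inj; rewrite /= inordK.
rewrite (e c5_0) (e c5_1) (e c5_2) (e c5_3) (e c5_4); ring.
Qed.

Lemma horner_quartic r t : (quartic r).[t] = (r *m nu t 1) ord0 ord0.
Proof. by rewrite quarticE row5E !mxE /= !hornerE /=; ring. Qed.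

Definition quadratic (a : 'rV[K]_3) : {poly K} :=
  (a ord0 c3_0)%:P * 'X^2 + (a ord0 c3_1)%:P * 'X + (a ord0 c3_2)%:P.

Lemma quartic_conv a b : quartic (conv a b) = quadratic a * quadratic b.
Proof.
rewrite quarticE /quadratic !mxE /= !(polyCD, polyCM); ring.
Qed.

End Coordinates.

(** * The Frobenius map and the subfields of K *)

Section Frobenius.
Set Implicit Arguments. Unset Strict Implicit.
Context {K : finFieldType}.

(** The order [q ^ 4] of the additive group is a power of the characteristic, hence so is [q], and
    q-th powers are additive. *)
Lemma power_map_rmorphism (q : nat) : (0 < q)%N -> #|K| = (q ^ 4)%N ->
  exists f : {rmorphism K -> K}, forall x, x ^+ q = f x.
Proof.
move=> q0 cardK; have [p pr_p pK] := finPcharP K.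
have pq : [pchar K].-nat q.
  have /and3P[+ _ _] := fin_ring_pchar_abelem pK.
  by rewrite /pgroup cardsT cardK pnatX orbF (eq_pnat _ (pcharf_eq pK)).
have gD : zmod_morphism (fun x : K => x ^+ q).
  by move=> x y; rewrite exprDn_pchar // exprNn_pchar.
have gM : monoid_morphism (fun x : K => x ^+ q).
  by split=> [|x y]; rewrite ?expr1n ?exprMn.
pose gA := GRing.isZmodMorphism.Build K K _ gD.
pose gN := GRing.isMonoidMorphism.Build K K _ gM.
pose f : {rmorphism K -> K} := HB.pack (fun x : K => x ^+ q) gA gN.
by exists f.
Qed.

(** The norm of [tau], its power with exponent q + 1, has order q - 1; its powers together with 0
    are the q elements. *)
Lemma Fsub_fixed_points q (tau : K) : (1 < q)%N ->
  (q ^ 2 - 1)%N.-primitive_root tau ->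
  exists2 s : seq K, all (Fsub q) s & uniq s /\ size s = q.
Proof.
move=> q1 tauP.
have [z zP] : exists z : K, (q - 1).-primitive_root z.
  exists (tau ^+ ((q ^ 2 - 1) %/ (q - 1))); apply: dvdn_prim_root => //.
  by have := subn_sqr q 1; rewrite exp1n => ->; rewrite dvdn_mulr.
exists (0 :: [seq z ^+ i | i <- iota 0 (q - 1)]).
  rewrite /= /Fsub expr0n gtn_eqF ?(ltnW q1) //= eqxx /=.
  apply/allP => _ /mapP[i _ ->]; rewrite -exprM mulnC exprM.
  by rewrite -{1}[q](@subnK 1) ?(ltnW q1) // exprD expr1 (prim_expr_order zP) mul1r.
split; last by rewrite /= size_map size_iota; lia.
rewrite /= map_inj_in_uniq ?iota_uniq ?andbT.
  apply/negP => /mapP[i _ /esym/eqP]; rewrite expf_eq0 => /andP[_ /eqP z0].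
  have := prim_expr_order zP; rewrite z0 expr0n subn_eq0 leqNgt q1 /= => /eqP.
  by rewrite eq_sym oner_eq0.
move=> i j; rewrite !mem_iota /= add0n => li lj /eqP.
by rewrite (eq_prim_root_expr zP) !modn_small // => /eqP.
Qed.

Lemma primitive_conj_neq q (tau : K) : (1 < q)%N ->
  (q ^ 2 - 1)%N.-primitive_root tau -> tau ^+ q != tau.
Proof.
move=> q1 tauP; rewrite -{2}[tau]expr1 (eq_prim_root_expr tauP).
by rewrite !modn_small ?(gtn_eqF q1) //; nia.
Qed.

Lemma primitive_Fsub q (tau : K) : (1 < q)%N ->
  (q ^ 2 - 1)%N.-primitive_root tau -> Fsub (q ^ 2) tau.
Proof.
move=> q1 tauP; rewrite /Fsub -{1}[(q ^ 2)%N](@subnK 1); last by rewrite expn_gt0; lia.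
by rewrite exprD (prim_expr_order tauP) mul1r.
Qed.

Lemma poly_eq0_by_roots (s : seq K) (p : {poly K}) :
  uniq s -> (size p <= size s)%N -> {in s, forall t, p.[t] = 0} -> p = 0.
Proof.
move=> us sp ps; apply: (@roots_geq_poly_eq0 _ p s) => //.
by apply/allP => t /ps /eqP.
Qed.

End Frobenius.

(** * Vanishing orders of quartic polynomials *)

Section Quartics.
Set Implicit Arguments. Unset Strict Implicit.
Context {K : finFieldType}.

Lemma dvdXn_monomial (f g : {poly K}) n :
  f = g * 'X^n -> (size f <= n.+1)%N -> f = (f.[1])%:P * 'X^n.
Proof.
move=> fE sf; have [g0|gn0] := eqVneq g 0.
  by rewrite fE g0 mul0r horner0 polyC0 mul0r.
have /size1_polyC gE : (size g <= 1)%N.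
  by move: sf; rewrite fE size_Mmonic ?monicXn // size_polyXn; lia.
by rewrite fE {}gE hornerM hornerC hornerXn expr1n mulr1.
Qed.

Lemma mup0_factor (f : {poly K}) : f != 0 -> exists g, f = g * 'X^(mup 0 f).
Proof.
move=> f0; have := @mup_geq _ 0 f (mup 0 f) f0.
by rewrite leqnn subr0 => /esym /dvdpP.
Qed.

(* Comparing vanishing orders at 0: that of f2 is even, positive and at most 3, hence 2. *)
Lemma quartic_ratio (f0 f1 f2 f3 f4 : {poly K}) :
  (size f0 <= 5)%N -> (size f1 <= 4)%N -> (size f2 <= 4)%N ->
  f0 != 0 -> f0.[0] = 0 -> f4.[0] != 0 ->
  f0 * f2 = f1 ^+ 2 -> f0 * f4 = f2 ^+ 2 -> f1 * f3 = f2 ^+ 2 ->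
  f1.[1] = f0.[1] ->
  let c := (f0.[1])%:P in
  [/\ f0 = c * 'X^4, f1 = c * 'X^3, f2 = c * 'X^2, f3 = c * 'X & f4 = c].
Proof.
move=> s0 s1 s2 f0n f00 f40 e02 e04 e13 f11 c.
have f4n : f4 != 0 by apply: contraNneq f40 => ->; rewrite horner0.
have sqrn (g : {poly K}) : g ^+ 2 != 0 -> g != 0 by rewrite expf_eq0.
have f2n : f2 != 0 by apply: sqrn; rewrite -e04 mulf_neq0.
have f1n : f1 != 0 by apply: sqrn; rewrite -e02 mulf_neq0.
have m0 : (0 < mup 0 f0)%N by rewrite -XsubC_dvd // dvdp_XsubCl; apply/rootP.
have m4 : mup 0 f4 = 0%N by rewrite mupNroot.
have m02 : (mup 0 f0 + mup 0 f2 = mup 0 f1 + mup 0 f1)%N by rewrite -!mupM // e02.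
have m04 : (mup 0 f0 + mup 0 f4 = mup 0 f2 + mup 0 f2)%N by rewrite -!mupM // e04.
have [g0 g0E] := mup0_factor f0n; have [g1 g1E] := mup0_factor f1n.
have m2 : mup 0 f2 = 2%N.
  have [g2 g2E] := mup0_factor f2n.
  have g2n : g2 != 0 by apply: contraNneq f2n => e; rewrite g2E e mul0r.
  move: s2; rewrite {1}g2E size_Mmonic ?monicXn // size_polyXn.
  by have := size_poly_gt0 g2; rewrite g2n => ?; lia.
have {m0 m02 m04} [m0 m1] : mup 0 f0 = 4%N /\ mup 0 f1 = 3%N by lia.
rewrite m0 in g0E; rewrite m1 in g1E.
have {g0 g0E} f0E := dvdXn_monomial g0E s0.
have {g1 g1E} f1E := dvdXn_monomial g1E s1.
rewrite f11 -/c in f1E; rewrite -/c in f0E.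
have cn : c != 0 by apply: contraNneq f0n => e; rewrite f0E e mul0r.
have f2E : f2 = c * 'X^2 by apply: (mulfI f0n); rewrite e02 f0E f1E; ring.
have f3E : f3 = c * 'X by apply: (mulfI f1n); rewrite e13 f1E f2E; ring.
have f4E : f4 = c by apply: (mulfI f0n); rewrite e04 f0E f2E; ring.
by [].
Qed.

End Quartics.

(** * The discriminant of a ternary quadratic form *)

Section Discriminant.
Set Implicit Arguments. Unset Strict Implicit.
Context {K : finFieldType}.

Lemma det_mx33 (W : 'M[K]_3) : \det W =
  W c3_0 c3_0 * (W c3_1 c3_1 * W c3_2 c3_2 - W c3_1 c3_2 * W c3_2 c3_1)
  - W c3_0 c3_1 * (W c3_1 c3_0 * W c3_2 c3_2 - W c3_1 c3_2 * W c3_2 c3_0)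
  + W c3_0 c3_2 * (W c3_1 c3_0 * W c3_2 c3_1 - W c3_1 c3_1 * W c3_2 c3_0).
Proof.
(* Entries indexed by natural numbers let the indices of nested minors be computed. *)
pose w i j := W (inord i) (inord j).
have wE i j : W i j = w i j by rewrite /w !inord_val.
have -> : W = \matrix_(i, j) w i j by apply/matrixP => i j; rewrite mxE wE.
rewrite !mxE /= (expand_det_row _ ord0) /cofactor !big_ord_recl big_ord0 !mxE /=.
rewrite !(expand_det_row _ ord0) /cofactor !big_ord_recl !big_ord0 !mxE /=.
rewrite !det_mx11 !mxE /= /bump /=; ring.
Qed.

(** [qdisc A] is half the determinant of [A + A^T], written with integer coefficients; the
    invariance is therefore a polynomial identity, valid also in characteristic 2. *)
Lemma qdisc_congr (A W : 'M[K]_3) : qdisc (W^T *m A *m W) = (\det W) ^+ 2 * qdisc A.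
Proof.
rewrite det_mx33 /qdisc !mxE !sum3E !mxE !sum3E !mxE; ring.
Qed.

End Discriminant.

(** * Secants and parametrizations of conics *)

Section Conics.
Set Implicit Arguments. Unset Strict Implicit.
Context {K : finFieldType}.

Lemma qfE (A : 'M[K]_3) w : qf A w =
  A c3_0 c3_0 * w c3_0 ord0 ^+ 2 + A c3_1 c3_1 * w c3_1 ord0 ^+ 2
  + A c3_2 c3_2 * w c3_2 ord0 ^+ 2
  + (A c3_1 c3_2 + A c3_2 c3_1) * (w c3_1 ord0 * w c3_2 ord0)
  + (A c3_0 c3_2 + A c3_2 c3_0) * (w c3_0 ord0 * w c3_2 ord0)
  + (A c3_0 c3_1 + A c3_1 c3_0) * (w c3_0 ord0 * w c3_1 ord0).
Proof. by rewrite /qf !mxE sum3E !mxE !sum3E !mxE; ring. Qed.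

Lemma qf_mulmx (A W : 'M[K]_3) w : qf A (W *m w) = qf (W^T *m A *m W) w.
Proof. by rewrite /qf trmx_mul !mulmxA. Qed.

Definition polar (A : 'M[K]_3) u v := qf A (u + v) - qf A u - qf A v.

Definition cols3 (u v w : 'cV[K]_3) : 'M[K]_3 :=
  \matrix_(i, j) [:: u i ord0; v i ord0; w i ord0]`_j.

Lemma cols3_mul u v w s : cols3 u v w *m s =
  s c3_0 ord0 *: u + s c3_1 ord0 *: v + s c3_2 ord0 *: w.
Proof. by apply/colP => i; rewrite !mxE sum3E !mxE /=; ring. Qed.

(** In the frame u, v, w the mixed coefficients of the form are the polars and its square
    coefficients are the values at u, v, w. Two of these values vanish, which leaves two terms of
    the discriminant. *)
Lemma qdisc_cols3 (A : 'M[K]_3) u v w : qf A u = 0 -> qf A v = 0 ->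
  let a := polar A u v in let b := polar A u w in let c := polar A v w in
  (\det (cols3 u v w)) ^+ 2 * qdisc A = a * b * c - qf A w * a ^+ 2.
Proof.
move=> u0 v0 /=; rewrite -qdisc_congr /qdisc; set B := _ *m _ *m _.
have B00 : B c3_0 c3_0 = 0.
  by rewrite -u0 qfE !mxE sum3E !mxE !sum3E !mxE /=; ring.
have B11 : B c3_1 c3_1 = 0.
  by rewrite -v0 qfE !mxE sum3E !mxE !sum3E !mxE /=; ring.
have B22 : B c3_2 c3_2 = qf A w.
  by rewrite qfE !mxE sum3E !mxE !sum3E !mxE /=; ring.
have B01 : B c3_0 c3_1 + B c3_1 c3_0 = polar A u v.
  by rewrite /polar !qfE !mxE !sum3E !mxE !sum3E !mxE /=; ring.
have B02 : B c3_0 c3_2 + B c3_2 c3_0 = polar A u w.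
  by rewrite /polar !qfE !mxE !sum3E !mxE !sum3E !mxE /=; ring.
have B12 : B c3_1 c3_2 + B c3_2 c3_1 = polar A v w.
  by rewrite /polar !qfE !mxE !sum3E !mxE !sum3E !mxE /=; ring.
rewrite B00 B11 B22 B01 B02 B12; ring.
Qed.

(* Otherwise the conic contains the line through the two points. *)
Lemma conic_secant (A : 'M[K]_3) u v : qdisc A != 0 -> qf A u = 0 -> qf A v = 0 ->
  u != 0 -> v != 0 -> ~ peq u v -> polar A u v != 0.
Proof.
move=> A0 u0 v0 un vn nuv; apply/negP => /eqP p0; apply: nuv; split=> //.
have det0 w : \det (cols3 u v w) = 0.
  have /eqP := qdisc_cols3 w u0 v0; rewrite p0 /= expr0n mulr0 !mul0r subr0.
  by rewrite mulf_eq0 (negPf A0) orbF expf_eq0 /= => /eqP.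
(* Unit vectors in the place of w turn the vanishing determinants into the vanishing 2 x 2 minors of
   u and v. *)
have m01 : u c3_0 ord0 * v c3_1 ord0 = u c3_1 ord0 * v c3_0 ord0.
  have := det0 (vec3 0 0 1); rewrite det_mx33 !mxE /= => e.
  by apply/eqP; rewrite -subr_eq0 -e; apply/eqP; ring.
have m02 : u c3_0 ord0 * v c3_2 ord0 = u c3_2 ord0 * v c3_0 ord0.
  have := det0 (vec3 0 1 0); rewrite det_mx33 !mxE /= => e.
  by apply/eqP; rewrite -subr_eq0 -oppr_eq0 -e; apply/eqP; ring.
have m12 : u c3_1 ord0 * v c3_2 ord0 = u c3_2 ord0 * v c3_1 ord0.
  have := det0 (vec3 1 0 0); rewrite det_mx33 !mxE /= => e.
  by apply/eqP; rewrite -subr_eq0 -e; apply/eqP; ring.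
have [k uk] : exists k, u k ord0 != 0.
  by apply/existsP; apply: contraNT un; rewrite negb_exists => /forallP e;
     apply/eqP/colP => i; rewrite mxE; apply/eqP; have := e i; rewrite negbK.
have vE : v = (v k ord0 / u k ord0) *: u.
  apply/colP => i; rewrite mxE mulrAC; apply: (mulIf uk); rewrite mulfVK //.
  move: k uk i; apply: ord3P => uk; apply: ord3P => //;
    by rewrite mulrC 1?[RHS]mulrC ?m01 ?m02 ?m12 // mulrC ?m01 ?m02 ?m12.
exists (v k ord0 / u k ord0) => //.
by apply: contraNneq vn => e; rewrite vE e scale0r.
Qed.

(* In the frame u, v, w the conic is a yz + b xz + c xy = 0, parametrized by
   x = a / s0, y = b / s1, z = - c / (s0 + s1); the substitution s0 = t1,
   s1 = - t0 puts u, v, w at the parameters (1 : 0), (0 : 1), (1 : 1). *)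
Definition conic_param (A : 'M[K]_3) u v w : 'M[K]_3 :=
  let a := polar A v w in let b := polar A u w in let c := polar A u v in
  cols3 u v w *m \matrix_(i, j)
    (nth [::] [:: [:: a; - a; 0]; [:: 0; - b; b]; [:: 0; c; 0]] i)`_j.

Lemma conic_paramE (A : 'M[K]_3) u v w t0 t1 : conic_param A u v w *m nu2 t0 t1 =
  (polar A v w * t0 * (t0 - t1)) *: u + (polar A u w * t1 * (t1 - t0)) *: v
  + (polar A u v * t0 * t1) *: w.
Proof.
rewrite /conic_param -mulmxA cols3_mul.
by congr (_ *: _ + _ *: _ + _ *: _); rewrite !mxE sum3E !mxE /=; ring.
Qed.

Lemma conic_param_on (A : 'M[K]_3) u v w t0 t1 :
  qf A u = 0 -> qf A v = 0 -> qf A w = 0 ->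
  qf A (conic_param A u v w *m nu2 t0 t1) = 0.
Proof.
move=> u0 v0 w0; rewrite conic_paramE.
have combE x y z : qf A (x *: u + y *: v + z *: w) =
  x ^+ 2 * qf A u + y ^+ 2 * qf A v + z ^+ 2 * qf A w
  + x * y * polar A u v + x * z * polar A u w + y * z * polar A v w.
  by rewrite /polar !qfE !mxE; ring.
by rewrite combE u0 v0 w0; ring.
Qed.

(** Both factors are invertible: the squared determinant of the frame times the discriminant is the
    product of the three polars, and the coefficient matrix has minus this product as
    determinant. *)
Lemma conic_param_unit (A : 'M[K]_3) u v w : qdisc A != 0 ->
  qf A u = 0 -> qf A v = 0 -> qf A w = 0 ->
  polar A u v != 0 -> polar A u w != 0 -> polar A v w != 0 ->
  conic_param A u v w \in unitmx.
Proof.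
move=> A0 u0 v0 w0 puv puw pvw; rewrite unitmx_mul !unitmxE; apply/andP; split.
  rewrite unitfE -sqrf_eq0; have /eqP := qdisc_cols3 w u0 v0.
  rewrite w0 mul0r subr0 => /eqP e; apply: contraNneq A0 => d0; apply/eqP.
  move: e; rewrite d0 mul0r => /esym/eqP.
  by rewrite !mulf_eq0 (negPf puv) (negPf puw) (negPf pvw).
rewrite unitfE det_mx33 !mxE /=.
set d := (X in X != 0); have -> : d = - (polar A v w * polar A u w * polar A u v).
  by rewrite /d; ring.
by rewrite oppr_eq0 !mulf_neq0.
Qed.

End Conics.

(** * The Bruck-Bose map in conjugate coordinates *)

Section BruckBose.
Set Implicit Arguments. Unset Strict Implicit.
Context {K : finFieldType} (sigma : {rmorphism K -> K}) (q : nat) (tau : K).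
Hypothesis sigmaE : forall x, x ^+ q = sigma x.
Hypothesis sigma_tau : sigma tau != tau.
Hypothesis sigma2_tau : sigma (sigma tau) = tau.

(* Over F_q these are the coordinates x, conj x, y, conj y, z of the affine
   point (x, y, z) which has x = x0 + x1 tau and y = y0 + y1 tau. *)
Definition conj_frame : 'M[K]_5 := \matrix_(i, j)
  (nth [::] [:: [:: 1; tau; 0; 0; 0]; [:: 1; sigma tau; 0; 0; 0];
                [:: 0; 0; 1; tau; 0]; [:: 0; 0; 1; sigma tau; 0];
                [:: 0; 0; 0; 0; 1]] i)`_j.

Lemma conj_frameE u : conj_frame *m u =
  vec5 (u c5_0 ord0 + u c5_1 ord0 * tau) (u c5_0 ord0 + u c5_1 ord0 * sigma tau)
       (u c5_2 ord0 + u c5_3 ord0 * tau) (u c5_2 ord0 + u c5_3 ord0 * sigma tau)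
       (u c5_4 ord0).
Proof. by apply: vec5P; rewrite !mxE sum5E !mxE /=; ring. Qed.

Lemma conj_frame_unit : conj_frame \in unitmx.
Proof.
have d0 : sigma tau - tau != 0 by rewrite subr_eq0.
pose d := sigma tau - tau.
(* The inverse, block by block: [d] is the determinant of the block with rows (1, tau) and (1, sigma
   tau). *)
pose D : 'M[K]_5 := \matrix_(i, j)
  (nth [::] [:: [:: sigma tau / d; - tau / d; 0; 0; 0]; [:: - d^-1; d^-1; 0; 0; 0];
                [:: 0; 0; sigma tau / d; - tau / d; 0]; [:: 0; 0; - d^-1; d^-1; 0];
                [:: 0; 0; 0; 0; 1]] i)`_j.
have /mulmx1_unit[] // : conj_frame *m D = 1%:M.
apply/matrixP; apply: ord5P; apply: ord5P; rewrite !mxE sum5E !mxE /= ?mulr1n ?mulr0n /d;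
  by field.
Qed.

(** The coordinates x/z, its conjugate, y/z, its conjugate and 1, cleared of denominators by the
    factor [z * sigma z]. *)
Definition bbv (V : 'cV[K]_3) : 'cV[K]_5 :=
  let x := V c3_0 ord0 in let y := V c3_1 ord0 in let z := V c3_2 ord0 in
  vec5 (x * sigma z) (sigma x * z) (y * sigma z) (sigma y * z) (z * sigma z).

Lemma bbvZ c V : bbv (c *: V) = (c * sigma c) *: bbv V.
Proof. by apply: vec5P; rewrite !mxE /= !rmorphM; ring. Qed.

Lemma bb_rel_bbv u v V : bb_rel q tau u v -> peq V v ->
  V c3_2 ord0 != 0 /\ peq (bbv V) (conj_frame *m u).
Proof.
move=> [x0 [x1 [y0 [y1 [[]]]]]]; rewrite /Fsub !sigmaE.
move=> /eqP sx0 /eqP sx1 /eqP sy0 /eqP sy1 vP uP Vv.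
have [_ [k k0 VE]] := peq_trans vP (peq_sym Vv).
have Vz : V c3_2 ord0 = k by rewrite VE !mxE /= mulr1.
split; first by rewrite Vz.
have -> : bbv V = (k * sigma k) *: (conj_frame *m vec5 x0 x1 y0 y1 1).
  rewrite VE bbvZ conj_frameE; congr (_ *: _); apply: vec5P;
  by rewrite !mxE /= ?rmorphD ?rmorphM ?rmorph1 ?sx0 ?sx1 ?sy0 ?sy1 ?mulr1 ?mul1r.
apply: peq_trans (peq_mulmx conj_frame_unit uP); apply/peq_sym/peqZ.
  by rewrite mulmx_unit_eq0 ?conj_frame_unit //; case: uP.
by rewrite mulf_neq0 ?fmorph_eq0.
Qed.

(** Conjugating [y = x0 + x1 * tau] gives a second linear equation; [x1] is the solution by Cramer's
    rule. *)
Lemma sigma2_decomp y : sigma (sigma y) = y ->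
  exists x0 x1, [/\ sigma x0 = x0, sigma x1 = x1 & y = x0 + x1 * tau].
Proof.
move=> sy; have d0 : sigma tau - tau != 0 by rewrite subr_eq0.
pose x1 := (sigma y - y) / (sigma tau - tau).
have sx1 : sigma x1 = x1.
  rewrite /x1 fmorph_div !rmorphB /= sy sigma2_tau.
  by rewrite -[y - _]opprB -[tau - _]opprB invrN mulrNN.
exists (y - x1 * tau), x1; split=> //; last by rewrite subrK.
rewrite rmorphB rmorphM /= sx1; apply/eqP; rewrite -subr_eq0 /x1; apply/eqP.
by field.
Qed.

Lemma bbv_bb_rel (V : 'cV[K]_3) : (forall i, sigma (sigma (V i ord0)) = V i ord0) ->
  V c3_2 ord0 != 0 ->
  exists u, bb_rel q tau u V /\ peq (bbv V) (conj_frame *m u).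
Proof.
move=> sV z0; set z := V c3_2 ord0 in z0 *.
have [|x0 [x1 [sx0 sx1 xE]]] := sigma2_decomp (y := V c3_0 ord0 / z).
  by rewrite !fmorph_div /= !sV.
have [|y0 [y1 [sy0 sy1 yE]]] := sigma2_decomp (y := V c3_1 ord0 / z).
  by rewrite !fmorph_div /= !sV.
exists (vec5 x0 x1 y0 y1 1).
have u0 : vec5 x0 x1 y0 y1 1 != 0.
  by apply/eqP => /colP /(_ c5_4) /eqP; rewrite !mxE /= oner_eq0.
have VE : V = z *: vec3 (x0 + x1 * tau) (y0 + y1 * tau) 1.
  by apply: vec3P; rewrite !mxE /= -?xE -?yE ?mulr1 // mulrC divfK.
have uV : bb_rel q tau (vec5 x0 x1 y0 y1 1) V.
  exists x0, x1, y0, y1; split.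
  - by rewrite /Fsub !sigmaE; split; apply/eqP.
  - rewrite VE; apply: peqZ => //.
    by apply/eqP => /colP /(_ c3_2) /eqP; rewrite !mxE /= oner_eq0.
  - exact: peq_refl.
split=> //; apply: (bb_rel_bbv uV _).2; apply: peq_refl.
by apply: contraNneq z0 => e; rewrite /z e mxE.
Qed.

End BruckBose.

(** * Rational normal quartic curves *)

Section RationalCurves.
Set Implicit Arguments. Unset Strict Implicit.
Context {K : finFieldType}.

Lemma quartic_inj : injective (@quartic K).
Proof.
move=> r r' e; have e' (i : 'I_5) : r ord0 (inord (4 - i)) = r' ord0 (inord (4 - i)).
  by have := congr1 (fun p : {poly K} => p`_i) e; rewrite !coef_poly ltn_ord.
apply/rowP => j; have := e' (rev_ord j); rewrite /= subSS.
have -> : (4 - (4 - j) = j)%N by have := ltn_ord j; lia.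
by rewrite inord_val.
Qed.

Lemma size_quartic (r : 'rV[K]_5) : (size (quartic r) <= 5)%N.
Proof. exact: size_poly. Qed.

Lemma size_quartic_lead0 (r : 'rV[K]_5) : r ord0 c5_0 = 0 -> (size (quartic r) <= 4)%N.
Proof.
move=> r0; apply/leq_sizeP => -[|[|[|[|[|j]]]]] // _; rewrite coef_poly //=.
by rewrite -[RHS]r0; congr (r _ _); apply: val_inj; rewrite /= inordK.
Qed.

Lemma size_quadratic (a : 'rV[K]_3) : (size (quadratic a) <= 3)%N.
Proof.
apply/leq_sizeP => -[|[|[|j]]] // _.
by rewrite /quadratic !coefD !coefCM coefXn coefX coefC /= !mulr0 !addr0.
Qed.

(* The quadrics through the standard normal rational curve pull back along
   L nu to binary forms of degree 8, which vanish at infinity and at the more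
   than 7 parameters in s, hence identically. *)
Lemma nrc_automorphism (L : 'M[K]_5) (s : seq K) : uniq s -> (7 < size s)%N ->
  {in s, forall t, exists u0 u1 k, L *m nu t 1 = k *: nu u0 u1} ->
  peq (nu 1 0) (L *m nu 1 0) -> peq (nu 0 1) (L *m nu 0 1) ->
  peq (nu 1 1) (L *m nu 1 1) -> exists2 c, c != 0 & L = c%:M.
Proof.
move=> us s7 sL [_ [k0 k0n L10]] [_ [k1 k1n L01]] [_ [c cn L11]].
pose f i := quartic (row i L).
have fE t i : (f i).[t] = (L *m nu t 1) i ord0.
  by rewrite horner_quartic -row_mul mxE.
have Li0 i : L i c5_0 = k0 * nu 1 0 i ord0.
  move/colP/(_ i): L10; rewrite mxE sum5E [RHS]mxE => <-.
  by rewrite !mxE /=; ring.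
have Li4 i : L i c5_4 = k1 * nu 0 1 i ord0.
  move/colP/(_ i): L01; rewrite mxE sum5E [RHS]mxE => <-.
  by rewrite !mxE /=; ring.
have f1 i : (f i).[1] = c.
  rewrite fE L11 mxE; move: i; apply: ord5P; rewrite mxE /=; ring.
have f0 i : (f i).[0] = k1 * nu 0 1 i ord0 by rewrite fE L01 mxE.
(* As L fixes the point [nu 1 0], every row but the first lacks the term in X^4. *)
have sf (i : 'I_5) : (0 < i)%N -> (size (f i) <= 4)%N.
  move=> i0; apply: size_quartic_lead0; rewrite mxE Li0.
  by move: i i0; apply: ord5P => // _; rewrite mxE /=; ring.
(* Only the factor [f i] can have degree 4, so both products have degree at most 7, and the at least
   8 elements of [s] suffice. *)
have rel (i j k l : 'I_5) : (0 < j)%N -> (0 < k)%N -> (0 < l)%N ->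
    (forall t0 t1 : K, nu t0 t1 i ord0 * nu t0 t1 j ord0 = nu t0 t1 k ord0 * nu t0 t1 l ord0) ->
    f i * f j = f k * f l.
  move=> j0 k0' l0 e; apply/eqP; rewrite -subr_eq0; apply/eqP.
  apply: (poly_eq0_by_roots us).
    apply: leq_trans s7; rewrite (leq_trans (size_polyD _ _)) // size_polyN geq_max.
    have si : (size (f i) <= 5)%N := size_quartic _.
    have := size_polyMleq (f i) (f j); have := size_polyMleq (f k) (f l).
    have := sf _ j0; have := sf _ k0'; have := sf _ l0.
    move: (size (f i * f j)) (size (f k * f l)).
    move: (size (f i)) (size (f j)) (size (f k)) (size (f l)) si.
    by move=> a1 a2 b1 b2 ? a b *; apply/andP; split; lia.
  move=> t /sL[u0 [u1 [k' Lt]]]; rewrite hornerD hornerN !hornerM !fE Lt.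
  have entry m : (k' *: nu u0 u1) m ord0 = k' * nu u0 u1 m ord0 by rewrite mxE.
  by rewrite !entry mulrACA [X in _ - X]mulrACA e subrr.
(* Three quadrics through the standard curve give the relations; the fixed points (0 : 1) and (1 :
   1) give the values at 0 and 1. *)
have [||||||||||f0E f1E f2E f3E f4E] :=
  @quartic_ratio K (f c5_0) (f c5_1) (f c5_2) (f c5_3) (f c5_4).
- exact: size_quartic.
- exact: sf.
- exact: sf.
- by apply: contraNneq cn => e; rewrite -(f1 c5_0) e horner0.
- by rewrite f0 mxE /=; ring.
- by rewrite f0 mxE /= expr1n mulr1.
- by rewrite expr2; apply: rel => // t0 t1; rewrite !mxE /=; ring.
- by rewrite expr2; apply: rel => // t0 t1; rewrite !mxE /=; ring.
- by rewrite expr2; apply: rel => // t0 t1; rewrite !mxE /=; ring.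
- by rewrite !f1.
rewrite f1 in f0E f1E f2E f3E f4E.
exists c => //; apply/row_matrixP => i; apply: quartic_inj; rewrite -/(f i).
by move: i; apply: ord5P; rewrite ?f0E ?f1E ?f2E ?f3E ?f4E
  quarticE !mxE /= ?mulr1n ?mulr0n; ring.
Qed.

(** The forms of [bbv] along the conic [G nu2], with H in the role of the conjugate of G.
    Conjugating coefficients only keeps the entries polynomial in the parameter, so the curve
    extends to all of K. *)
Definition conj_products (G H : 'M[K]_3) : 'M[K]_5 := \matrix_(i, j)
  (nth 0 [:: conv (row c3_0 G) (row c3_2 H); conv (row c3_0 H) (row c3_2 G);
             conv (row c3_1 G) (row c3_2 H); conv (row c3_1 H) (row c3_2 G);
             conv (row c3_2 G) (row c3_2 H)] i) ord0 j.

Lemma conj_productsE (G H : 'M[K]_3) t0 t1 : conj_products G H *m nu t0 t1 =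
  let v := G *m nu2 t0 t1 in let w := H *m nu2 t0 t1 in
  vec5 (v c3_0 ord0 * w c3_2 ord0) (w c3_0 ord0 * v c3_2 ord0)
       (v c3_1 ord0 * w c3_2 ord0) (w c3_1 ord0 * v c3_2 ord0)
       (v c3_2 ord0 * w c3_2 ord0).
Proof.
apply/colP; have rowE i : row i (conj_products G H) = nth 0
  [:: conv (row c3_0 G) (row c3_2 H); conv (row c3_0 H) (row c3_2 G);
      conv (row c3_1 G) (row c3_2 H); conv (row c3_1 H) (row c3_2 G);
      conv (row c3_2 G) (row c3_2 H)] i by apply/rowP => j; rewrite !mxE.
have mulE m (A : 'M[K]_(m, 3)) (u : 'cV_3) i : (row i A *m u) ord0 ord0 = (A *m u) i ord0.
  by rewrite -row_mul mxE.
have mulE5 (A : 'M[K]_5) (u : 'cV_5) i : (A *m u) i ord0 = (row i A *m u) ord0 ord0.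
  by rewrite -row_mul [RHS]mxE.
by apply: ord5P; rewrite mulE5 rowE /= conv_nu !mulE [RHS]mxE.
Qed.

End RationalCurves.

(** * Matching a parametrization of the conic with the given curve *)

Section Parametrization.
Set Implicit Arguments. Unset Strict Implicit.
Context {K : finFieldType} (sigma : {rmorphism K -> K}) (q : nat) (tau : K).
Hypothesis q7 : (7 < q)%N.
Hypothesis sigmaE : forall x, x ^+ q = sigma x.
Hypothesis tauP : (q ^ 2 - 1)%N.-primitive_root tau.

Lemma FsubP x : reflect (sigma x = x) (Fsub q x).
Proof. by rewrite /Fsub sigmaE; apply: eqP. Qed.

Lemma Fsub2P x : reflect (sigma (sigma x) = x) (Fsub (q ^ 2) x).
Proof. by rewrite /Fsub expnS expn1 exprM !sigmaE; apply: eqP. Qed.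

Lemma sigma_tau_neq : sigma tau != tau.
Proof. by rewrite -sigmaE; apply: primitive_conj_neq tauP; apply: leq_trans q7. Qed.

Lemma sigma2_tau : sigma (sigma tau) = tau.
Proof. by apply/Fsub2P/primitive_Fsub => //; apply: leq_trans q7. Qed.

(** A parameter fixed by [sigma] is untouched when the point is conjugated, so conjugation acts on
    the coefficients alone. *)
Lemma bbv_conj_products (G : 'M[K]_3) t0 t1 : sigma t0 = t0 -> sigma t1 = t1 ->
  conj_products G (map_mx sigma G) *m nu t0 t1 = bbv sigma (G *m nu2 t0 t1).
Proof.
move=> s0 s1; rewrite conj_productsE.
have -> : map_mx sigma G *m nu2 t0 t1 = map_mx sigma (G *m nu2 t0 t1).
  rewrite map_mxM; congr (_ *m _).
  by apply: vec3P; rewrite !mxE /= ?rmorphXn ?rmorphM /= ?s0 ?s1.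
by rewrite /bbv; apply: vec5P; rewrite !mxE.
Qed.

Lemma sigma_mulmx m n p (f : {rmorphism K -> K}) (A : 'M[K]_(m, n)) (B : 'M[K]_(n, p)) :
  (forall i j, f (A i j) = A i j) -> (forall i j, f (B i j) = B i j) ->
  forall i j, f ((A *m B) i j) = (A *m B) i j.
Proof.
move=> fA fB i j; rewrite mxE rmorph_sum; apply: eq_bigr => k _.
by rewrite rmorphM fA fB.
Qed.

(** The five expressions are the coefficients of the binary quartic [qf B (nu2 t0 t1)], which has q
    > 4 roots. The form of B is then a multiple of x z - y^2. *)
Lemma quadric_on_curve (B : 'M[K]_3) :
  (forall t, sigma t = t -> qf B (nu2 t 1) = 0) ->
  [/\ B c3_0 c3_0 = 0, B c3_0 c3_1 + B c3_1 c3_0 = 0,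
      B c3_0 c3_2 + B c3_2 c3_0 + B c3_1 c3_1 = 0,
      B c3_1 c3_2 + B c3_2 c3_1 = 0 & B c3_2 c3_2 = 0].
Proof.
move=> B0; pose r : 'rV[K]_5 := \row_j [:: B c3_0 c3_0; B c3_0 c3_1 + B c3_1 c3_0;
  B c3_0 c3_2 + B c3_2 c3_0 + B c3_1 c3_1; B c3_1 c3_2 + B c3_2 c3_1; B c3_2 c3_2]`_j.
have [s /allP sq [us ss]] := Fsub_fixed_points (ltn_trans (isT : 1 < 7)%N q7) tauP.
have r0 : quartic r = 0.
  apply: (poly_eq0_by_roots us).
    by rewrite ss (leq_trans (size_quartic r)) // (leq_trans _ q7).
  move=> t /sq /FsubP /B0 <-; rewrite horner_quartic row5E qfE !mxE /=; ring.
have rE j : r ord0 j = 0.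
  have -> : r = 0 by apply: quartic_inj; rewrite r0 quarticE !mxE polyC0; ring.
  by rewrite mxE.
by split; [have := rE c5_0|have := rE c5_1|have := rE c5_2|have := rE c5_3|have := rE c5_4];
  rewrite mxE.
Qed.

Variables (M A Ap : 'M[K]_3) (N : 'M[K]_5).
Hypothesis sM : mover (Fsub (q ^ 2)) M.
Hypothesis uM : M \in unitmx.
Hypothesis A0 : qdisc A != 0.
Hypothesis sA : mover (Fsub q) A.
Hypothesis affC : forall v, in_B q M v -> v c3_2 ord0 = 0 -> ~ in_C q M A v.
Hypothesis ApC : forall v, in_C q M A v -> qf Ap v = 0.
Hypothesis uN : N \in unitmx.
Hypothesis curveN : forall u, in_bbC q tau M A u <-> on_nrc (Fsub q) N u.

Let E := conj_frame sigma tau.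
Let uE : E \in unitmx := conj_frame_unit sigma_tau_neq.

Let sigma2M i j : sigma (sigma (M i j)) = M i j.
Proof. exact/Fsub2P/sM. Qed.

Lemma conic_point_of_param t0 t1 : sigma t0 = t0 -> sigma t1 = t1 ->
  (t0, t1) != (0, 0) ->
  exists w : 'cV[K]_3, [/\ forall i, sigma (w i ord0) = w i ord0, w != 0, qf A w = 0
    & peq (bbv sigma (M *m w)) (E *m N *m nu t0 t1)].
Proof.
move=> /FsubP s0 /FsubP s1 t.
have /curveN[v [[w [sw w0 Aw wv]] vu]] : on_nrc (Fsub q) N (N *m nu t0 t1).
  by exists t0, t1; split=> //; apply: peq_refl; rewrite mulmx_unit_eq0 // nu_eq0.
exists w; split=> //; first by move=> i; apply/FsubP/sw.
by rewrite -mulmxA; case: (bb_rel_bbv sigmaE sigma_tau_neq vu wv).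
Qed.

Lemma param_of_conic_point (w : 'cV[K]_3) : (forall i, sigma (w i ord0) = w i ord0) ->
  w != 0 -> qf A w = 0 ->
  exists t0 t1, peq (E *m N *m nu t0 t1) (bbv sigma (M *m w)).
Proof.
move=> sw w0 Aw; have Mw0 : M *m w != 0 by rewrite mulmx_unit_eq0.
have sw' : vover (Fsub q) w by move=> i; apply/FsubP.
have CMw : in_C q M A (M *m w) by exists w; split=> //; apply: peq_refl.
have BMw : in_B q M (M *m w) by exists w; split=> //; apply: peq_refl.
(* The only point of the subplane at infinity is off C, so every point of C is affine and has an
   image under the Bruck-Bose map. *)
have z0 : (M *m w) c3_2 ord0 != 0 by apply/negP => /eqP /(affC BMw); apply.
have s2 i : sigma (sigma ((M *m w) i ord0)) = (M *m w) i ord0.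
  by apply: (@sigma_mulmx _ _ _ (sigma \o sigma)%FUN) => j k /=; rewrite ?sigma2M // !ord1 !sw.
have [u [uV ub]] := bbv_bb_rel sigmaE sigma_tau_neq sigma2_tau s2 z0.
have /curveN[t0 [t1 [_ _ t Nu]]] : in_bbC q tau M A u by exists (M *m w).
exists t0, t1; rewrite -mulmxA; apply: peq_trans (peq_sym ub).
exact: peq_mulmx Nu.
Qed.

(** G is M times the conic parametrization through the points of C lying under the parameters (1 :
    0), (0 : 1), (1 : 1) of N. The conditions on B say that C+ contains the whole conic [G nu2]. *)
Lemma curve_parametrization : exists (G : 'M[K]_3) c,
  [/\ G \in unitmx, c != 0, forall i j, sigma (sigma (G i j)) = G i j,
      E *m N = c *: conj_products G (map_mx sigma G) &
      let B := G^T *m Ap *m G in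
      [/\ B c3_0 c3_0 = 0, B c3_0 c3_1 + B c3_1 c3_0 = 0,
          B c3_0 c3_2 + B c3_2 c3_0 + B c3_1 c3_1 = 0,
          B c3_1 c3_2 + B c3_2 c3_1 = 0 & B c3_2 c3_2 = 0]].
Proof.
have uEN : E *m N \in unitmx by rewrite unitmx_mul uE.
have s0 := rmorph0 sigma; have s1 := rmorph1 sigma.
have n10 : ((1, 0) : K * K) != (0, 0) by rewrite xpair_eqE oner_eq0.
have n01 : ((0, 1) : K * K) != (0, 0) by rewrite xpair_eqE oner_eq0 andbF.
have n11 : ((1, 1) : K * K) != (0, 0) by rewrite xpair_eqE oner_eq0.
have [u [su u0 Au uN0]] := conic_point_of_param s1 s0 n10.
have [v [sv v0 Av vN]] := conic_point_of_param s0 s1 n01.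
have [w [sw w0 Aw wN]] := conic_point_of_param s1 s1 n11.
(* Equal conic points have equal parameters; hence u, v, w are pairwise distinct and their polars
   are nonzero. *)
have npeq (x y : 'cV[K]_3) t0 t1 r0 r1 : peq (bbv sigma (M *m x)) (E *m N *m nu t0 t1) ->
    peq (bbv sigma (M *m y)) (E *m N *m nu r0 r1) -> peq x y -> peq (nu t0 t1) (nu r0 r1).
  move=> xt yr [_ [k k0 yE]]; apply: (peq_mulmxI uEN).
  apply: peq_trans yr; apply: peq_trans (peq_sym xt) _.
  rewrite yE -scalemxAr bbvZ; apply: peqZ; first by case: xt.
  by rewrite mulf_neq0 ?fmorph_eq0.
have puv : polar A u v != 0.
  apply: conic_secant => // /(npeq _ _ _ _ _ _ uN0 vN) [_ [k k0 /colP /(_ c5_4)]].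
  by rewrite !mxE /= expr1n expr0n mulr0 => /eqP; rewrite oner_eq0.
have puw : polar A u w != 0.
  apply: conic_secant => // /(npeq _ _ _ _ _ _ uN0 wN) [_ [k k0 /colP /(_ c5_4)]].
  by rewrite !mxE /= expr1n expr0n mulr0 => /eqP; rewrite oner_eq0.
have pvw : polar A v w != 0.
  apply: conic_secant => // /(npeq _ _ _ _ _ _ vN wN) [_ [k k0 /colP /(_ c5_0)]].
  by rewrite !mxE /= expr1n expr0n mulr0 => /eqP; rewrite oner_eq0.
pose T := conic_param A u v w.
have uT : T \in unitmx by apply: conic_param_unit.
have T_on t0 t1 : qf A (T *m nu2 t0 t1) = 0 by apply: conic_param_on.
have spolar (x y : 'cV[K]_3) : (forall i, sigma (x i ord0) = x i ord0) ->
    (forall i, sigma (y i ord0) = y i ord0) -> sigma (polar A x y) = polar A x y.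
  have sAij i j : sigma (A i j) = A i j by apply/FsubP/sA.
  move=> sx sy; rewrite /polar !qfE !mxE !(rmorphB, rmorphD, rmorphM, rmorphXn) /=.
  by rewrite !sAij !sx !sy.
have sT i j : sigma (T i j) = T i j.
  apply: sigma_mulmx => {}i {}j; move: i j; apply: ord3P; apply: ord3P; rewrite !mxE /=
    ?rmorphN ?rmorph0 /= ?spolar //.
pose G := M *m T.
have s2G i j : sigma (sigma (G i j)) = G i j.
  apply: (@sigma_mulmx _ _ _ (sigma \o sigma)%FUN) => {}i {}j /=; first exact: sigma2M.
  by rewrite !sT.
have uG : G \in unitmx by rewrite unitmx_mul uM.
pose R := conj_products G (map_mx sigma G).
have RE t0 t1 : sigma t0 = t0 -> sigma t1 = t1 ->
    R *m nu t0 t1 = bbv sigma (M *m (T *m nu2 t0 t1)).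
  by move=> st0 st1; rewrite mulmxA; apply: bbv_conj_products.
have sTnu t0 t1 : sigma t0 = t0 -> sigma t1 = t1 ->
    forall i, sigma ((T *m nu2 t0 t1) i ord0) = (T *m nu2 t0 t1) i ord0.
  move=> st0 st1 i; apply: sigma_mulmx => // {}i j; move: i; apply: ord3P;
  by rewrite !mxE /= ?rmorphXn ?rmorphM /= ?st0 ?st1.
have [s /allP sq [us ss]] := Fsub_fixed_points (ltn_trans (isT : 1 < 7)%N q7) tauP.
(* [L] compares the two parametrizations; it turns out to be scalar. *)
pose L := invmx (E *m N) *m R.
have LE t0 t1 x : peq (bbv sigma (M *m x)) (E *m N *m nu t0 t1) ->
    sigma t0 = t0 -> sigma t1 = t1 -> peq x (T *m nu2 t0 t1) ->
    peq (nu t0 t1) (L *m nu t0 t1).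
  move=> xN st0 st1 [_ [k k0 xE]]; apply: (peq_mulmxI uEN).
  rewrite mulmxA mulKVmx // RE // xE -scalemxAr bbvZ.
  apply: peq_trans (peq_sym xN) (peqZ _ _); first by case: xN.
  by rewrite mulf_neq0 ?fmorph_eq0.
have [|||||c c0 Lc] := nrc_automorphism (L := L) us; first by rewrite ss.
(* For t in F_q the point [T nu2 t] is on the conic, so its image is on the given curve, at a
   possibly different parameter. *)
- move=> t /sq /FsubP st.
  have Tt0 : T *m nu2 t 1 != 0.
    by rewrite mulmx_unit_eq0 // nu2_eq0 xpair_eqE oner_eq0 andbF.
  have [t0 [t1 [_ [k k0 e]]]] := param_of_conic_point (sTnu _ _ st s1) Tt0 (T_on t 1).
  exists t0, t1, k; rewrite -mulmxA RE // e -!scalemxAr; congr (_ *: _).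
  by rewrite mulKmx.
- apply: LE uN0 _ _ _ => //; rewrite conic_paramE.
  have -> : polar A v w * 1 * (1 - 0) = polar A v w by ring.
  by rewrite !(mulr0, mul0r) !scale0r !addr0; apply: peqZ.
- apply: LE vN _ _ _ => //; rewrite conic_paramE.
  have -> : polar A u w * 1 * (1 - 0) = polar A u w by ring.
  by rewrite !(mulr0, mul0r) !scale0r addr0 add0r; apply: peqZ.
- apply: LE wN _ _ _ => //; rewrite conic_paramE.
  by rewrite !mulr1 subrr !mulr0 !scale0r !add0r; apply: peqZ.
exists G, c^-1; split=> //; first by rewrite invr_eq0.
  have -> : conj_products G (map_mx sigma G) = c *: (E *m N).
    by rewrite -/R -(mulKVmx uEN R) -/L Lc mul_mx_scalar.
  by rewrite scalerA mulVf // scale1r.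
(* The points of [G nu2] with parameter in F_q are points of C, hence of C+. *)
apply: quadric_on_curve => t st; rewrite -qf_mulmx -mulmxA; apply: ApC.
exists (T *m nu2 t 1); have T0 : T *m nu2 t 1 != 0.
  by rewrite mulmx_unit_eq0 // nu2_eq0 xpair_eqE oner_eq0 andbF.
split=> //; first by move=> i; apply/FsubP/sTnu.
by apply: peq_refl; rewrite mulmx_unit_eq0.
Qed.

End Parametrization.

(** * Points of the projective line, of the quartic and of the transversal *)

Section ProjectiveLine.
Set Implicit Arguments. Unset Strict Implicit.
Context {K : finFieldType}.
Implicit Types (u v w : K * K).

Lemma pair_neq0 (x y : K) : ((x, y) != (0, 0)) = (x != 0) || (y != 0).
Proof. by rewrite xpair_eqE negb_and. Qed.

Lemma peq2_cross u v : u != (0, 0) -> v != (0, 0) -> u.1 * v.2 = u.2 * v.1 -> peq2 u v.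
Proof.
case: u v => [u1 u2] [v1 v2] /= un vn e; split=> //=.
have [u10|u1n] := eqVneq u1 0.
  have u2n : u2 != 0 by rewrite pair_neq0 u10 eqxx in un.
  have v10 : v1 = 0 by apply: (mulfI u2n); rewrite -e u10 mul0r mulr0.
  have v2n : v2 != 0 by rewrite pair_neq0 v10 eqxx in vn.
  by exists (v2 / u2); rewrite ?mulf_neq0 ?invr_eq0 // u10 v10 mulr0 divfK.
have v1n : v1 != 0.
  apply: contraNneq vn => v10; rewrite v10 mulr0 in e.
  by move/eqP: e; rewrite mulf_eq0 (negPf u1n) v10 => /eqP ->.
exists (v1 / u1); rewrite ?mulf_neq0 ?invr_eq0 // divfK //.
by rewrite mulrAC -[v1 * u2]mulrC -e mulrAC mulfV // mul1r.
Qed.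

Lemma peq2_neq0 u v : peq2 u v -> v != (0, 0).
Proof.
move=> [un [k k0 ->]]; move: un; rewrite [in X in X -> _](surjective_pairing u) !pair_neq0.
by rewrite !mulf_eq0 (negPf k0).
Qed.

Lemma peq2_trans u v w : peq2 u v -> peq2 v w -> peq2 u w.
Proof.
move=> [un [k k0 ->]] [_ [l l0 ->]]; split=> //=.
by exists (l * k); rewrite ?mulf_neq0 ?mulrA.
Qed.

Lemma pt2over_peq2 (S : pred K) u v : peq2 u v -> pt2over S v -> pt2over S u.
Proof.
move=> [un [k k0 ->]] [_ [l l0 /= lS]]; split=> //.
by exists (l * k); rewrite ?mulf_neq0 // -!mulrA.
Qed.

Lemma nu_peq2 t0 t1 s0 s1 : peq2 (t0, t1) (s0, s1) -> @peq K 5 (nu t0 t1) (nu s0 s1).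
Proof.
move=> [tn [k k0 [-> ->]]]; split; first by rewrite nu_eq0.
by exists (k ^+ 4); rewrite ?expf_neq0 //; apply: vec5P; rewrite !mxE /=; ring.
Qed.

(** The first two entries of [nu] are in the ratio t0 : t1 if [t0] is nonzero; otherwise the first
    entry forces [s0 = 0]. *)
Lemma nu_peqI t0 t1 s0 s1 : @peq K 5 (nu t0 t1) (nu s0 s1) -> peq2 (t0, t1) (s0, s1).
Proof.
move=> ts; have sn : nu s0 s1 != 0 by case: (peq_sym ts).
case: ts => tn [k k0 /colP e]; rewrite !nu_eq0 in tn sn.
have e0 : s0 ^+ 4 = k * t0 ^+ 4 by have := e c5_0; rewrite !mxE.
have e1 : s0 ^+ 3 * s1 = k * (t0 ^+ 3 * t1) by have := e c5_1; rewrite !mxE.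
have e3 : s0 * s1 ^+ 3 = k * (t0 * t1 ^+ 3) by have := e c5_3; rewrite !mxE.
have e4 : s1 ^+ 4 = k * t1 ^+ 4 by have := e c5_4; rewrite !mxE.
apply: peq2_cross => //=; have [t00|t0n] := eqVneq t0 0.
  have s00 : s0 = 0.
    by apply/eqP; rewrite -[_ == 0](expf_eq0 s0 4) e0 t00 expr0n mulr0.
  by rewrite t00 s00 mulr0 mul0r.
have s0n : s0 != 0.
  by rewrite -[_ == 0](expf_eq0 s0 4) e0 mulf_neq0 // expf_neq0.
apply: (mulfI (mulf_neq0 k0 (mulf_neq0 (expf_neq0 3 t0n) (expf_neq0 3 s0n)))).
have -> : k * (t0 ^+ 3 * s0 ^+ 3) * (t0 * s1) = k * t0 ^+ 4 * (s0 ^+ 3 * s1) by ring.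
by rewrite -e0 e1; ring.
Qed.

Variables (q : nat) (tau : K).

Lemma gptE p : gpt q tau p =
  vec5 (p.1 * tau ^+ q) (- p.1) (p.2 * tau ^+ q) (- p.2) 0.
Proof. by apply: vec5P; rewrite !mxE /=; ring. Qed.

Lemma gpt_eq0 p : (gpt q tau p == 0) = (p == (0, 0)).
Proof.
case: p => a b; rewrite gptE /=; apply/eqP/eqP => [/colP e|[-> ->]].
  have := e c5_1; have := e c5_3; rewrite !mxE /= => /eqP + /eqP.
  by rewrite !oppr_eq0 => /eqP -> /eqP ->.
by apply: vec5P; rewrite !mxE /= ?mul0r ?oppr0.
Qed.

Lemma gptZ k p : gpt q tau (k * p.1, k * p.2) = k *: gpt q tau p.
Proof. by rewrite /gpt /= !scalerDr !scalerA. Qed.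

Lemma gpt_peq p r : peq (gpt q tau p) (gpt q tau r) <-> peq2 p r.
Proof.
split=> [[pn [k k0 /colP e]]|[pn [k k0 ->]]]; last first.
  by rewrite gptZ; apply: peqZ; rewrite ?gpt_eq0.
split; first by rewrite -gpt_eq0.
exists k => //; rewrite [LHS]surjective_pairing.
have := e c5_1; have := e c5_3; rewrite !gptE !mxE /=.
by rewrite !mulrN => /oppr_inj -> /oppr_inj ->.
Qed.

End ProjectiveLine.

(** * Intersection of the curve with the transversal *)

Section Transversal.
Set Implicit Arguments. Unset Strict Implicit.
Context {K : finFieldType} (sigma : {rmorphism K -> K}) (q : nat) (tau : K).
Hypothesis sigmaE : forall x, x ^+ q = sigma x.
Hypothesis sigma4 : forall x, sigma (sigma (sigma (sigma x))) = x.
Hypothesis sigma_tau : sigma tau != tau.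
Hypothesis sigma2_tau : sigma (sigma tau) = tau.
Variables (Ap G : 'M[K]_3) (N : 'M[K]_5) (c k : K) (pb qb : K * K).
Let E := conj_frame sigma tau.
Let Gs := map_mx sigma G.
Let uE : E \in unitmx := conj_frame_unit sigma_tau.
Hypothesis sAp : mover (Fsub (q ^ 2)) Ap.
Hypothesis pbn : pb != (0, 0).
Hypothesis qbn : qb != (0, 0).
Hypothesis k0 : k != 0.
Hypothesis Ap00 : Ap c3_0 c3_0 = k * pb.2 * qb.2.
Hypothesis Ap01 : Ap c3_0 c3_1 + Ap c3_1 c3_0 = - (k * (pb.2 * qb.1 + pb.1 * qb.2)).
Hypothesis Ap11 : Ap c3_1 c3_1 = k * pb.1 * qb.1.
Hypothesis sN : mover (Fsub q) N.
Hypothesis uN : N \in unitmx.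
Hypothesis uG : G \in unitmx.
Hypothesis c0 : c != 0.
Hypothesis sG : forall i j, sigma (sigma (G i j)) = G i j.
Hypothesis NE : E *m N = c *: conj_products G Gs.
Hypothesis ApG : let B := G^T *m Ap *m G in
  [/\ B c3_0 c3_0 = 0, B c3_0 c3_1 + B c3_1 c3_0 = 0,
      B c3_0 c3_2 + B c3_2 c3_0 + B c3_1 c3_1 = 0,
      B c3_1 c3_2 + B c3_2 c3_1 = 0 & B c3_2 c3_2 = 0].

Local Notation S2 := (@Fsub K (q ^ 2)).
Local Notation P := (gpt q tau pb).
Local Notation Q := (gpt q tau qb).
Local Notation vG t0 t1 := (G *m nu2 t0 t1).

Let S2P x : reflect (sigma (sigma x) = x) (S2 x) := Fsub2P sigmaE x.

Let S2M x y : S2 x -> S2 y -> S2 (x * y).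
Proof. by move=> /S2P sx /S2P sy; apply/S2P; rewrite !rmorphM /= sx sy. Qed.

Let S2V x : S2 x -> S2 x^-1.
Proof. by move=> /S2P sx; apply/S2P; rewrite !fmorphV sx. Qed.

Let S2N x : S2 x -> S2 (- x).
Proof. by move=> /S2P sx; apply/S2P; rewrite !rmorphN /= sx. Qed.

Let uGs : Gs \in unitmx.
Proof. by rewrite map_unitmx. Qed.

(** The entries tau^q and -1 of [A0] and [A1] are chosen so that x0 + x1 tau^q vanishes: g is the
    line where the second, fourth and fifth coordinates are 0. *)
Lemma EgptE p : E *m gpt q tau p =
  (sigma tau - tau) *: vec5 p.1 0 p.2 0 0.
Proof.
rewrite conj_frameE gptE sigmaE; apply: vec5P; rewrite !mxE /=; ring.
Qed.

Lemma line_gpt a b : a *: A0 q tau + b *: A1 q tau = gpt q tau (a, b).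
Proof. by []. Qed.

Let ENE t0 t1 : E *m (N *m nu t0 t1) = c *: (conj_products G Gs *m nu t0 t1).
Proof. by rewrite mulmxA NE scalemxAl. Qed.

(** On g the products x' z, y' z, z' z vanish; a nonzero z would annihilate the conjugate point (x',
    y', z'), which is nonzero as [Gs] is invertible. *)
Lemma Nnu_on_line t0 t1 p : (t0, t1) != (0, 0) -> N *m nu t0 t1 = gpt q tau p ->
  vG t0 t1 c3_2 ord0 = 0.
Proof.
move=> tn e; have := ENE t0 t1; rewrite e EgptE conj_productsE /= !scale_vec5 !mulr0.
case/vec5_inj => _ e1 _ e3 e4.
have w0 : Gs *m nu2 t0 t1 != 0 by rewrite mulmx_unit_eq0 // nu2_eq0.
apply/eqP; apply: contraNT w0 => zn; apply/eqP.
have z0 x : 0 = c * (x * vG t0 t1 c3_2 ord0) -> x = 0.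
  by move=> /esym/eqP; rewrite mulf_eq0 (negPf c0) mulf_eq0 (negPf zn) orbF => /eqP.
by apply: vec3P; rewrite [RHS]mxE; apply: z0 => //; rewrite [X in _ * X]mulrC.
Qed.

(** For z = 0 only x z' and y z' survive. Their common factor z' is nonzero because the curve point
    is. *)
Lemma line_Nnu t0 t1 : (t0, t1) != (0, 0) -> vG t0 t1 c3_2 ord0 = 0 ->
  peq (gpt q tau (vG t0 t1 c3_0 ord0, vG t0 t1 c3_1 ord0)) (N *m nu t0 t1).
Proof.
move=> tn z0; pose d := c * (Gs *m nu2 t0 t1) c3_2 ord0 / (sigma tau - tau).
have dn : sigma tau - tau != 0 by rewrite subr_eq0.
set p := (_, _).
have e : N *m nu t0 t1 = d *: gpt q tau p.
  rewrite -[LHS](mulKmx uE) -[RHS](mulKmx uE); congr (_ *m _).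
  rewrite ENE conj_productsE /= z0 -scalemxAr EgptE !scalerA divfK //.
  rewrite !scale_vec5; congr vec5; rewrite /p /=; ring.
have Nn : N *m nu t0 t1 != 0 by rewrite mulmx_unit_eq0 // nu_eq0.
move: (Nn); rewrite e scaler_eq0 negb_or => /andP[d0 pn].
exact: peqZ.
Qed.

Definition form_inf (u : K * K) :=
  (pb.2 * u.1 - pb.1 * u.2) * (qb.2 * u.1 - qb.1 * u.2).

Lemma qf_inf a b : qf Ap (vec3 a b 0) = k * form_inf (a, b).
Proof. by rewrite qfE !mxE /= Ap00 Ap11 Ap01 /form_inf /=; ring. Qed.

Lemma form_inf_root u : u != (0, 0) -> form_inf u = 0 -> peq2 pb u \/ peq2 qb u.
Proof.
move=> un /eqP; rewrite mulf_eq0 !subr_eq0 => /orP[/eqP e|/eqP e]; [left|right];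
  exact: peq2_cross.
Qed.

Lemma vG_conic t0 t1 : qf Ap (vG t0 t1) = 0.
Proof.
rewrite qf_mulmx; move: (_ *m _ *m _) ApG => B [B00 B01 B02 B12 B22].
rewrite qfE B00 B22 B01 B12 !mxE /=.
transitivity ((B c3_0 c3_2 + B c3_2 c3_0 + B c3_1 c3_1) * (t0 ^+ 2 * t1 ^+ 2)); first by ring.
by rewrite B02 mul0r.
Qed.

Lemma Nnu_PQ t0 t1 : (t0, t1) != (0, 0) -> vG t0 t1 c3_2 ord0 = 0 ->
  peq P (N *m nu t0 t1) \/ peq Q (N *m nu t0 t1).
Proof.
move=> tn z0; have := line_Nnu tn z0; set p := (_, _) => pN.
have pn : p != (0, 0) by rewrite -(gpt_eq0 q tau); case: pN.
have : form_inf p = 0.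
  apply: (mulfI k0); rewrite mulr0 -qf_inf -[RHS](vG_conic t0 t1); congr (qf _ _).
  by apply: vec3P; rewrite [LHS]mxE /= ?z0.
move=> /(form_inf_root pn) [pp|qp]; [left|right];
  by apply: peq_trans pN; apply/gpt_peq.
Qed.

(** Pulled back along G, the conic C+ is [e] times x z - y^2, whose zeros are the points of
    [nu2]. *)
Lemma conic_point_param v : v != 0 -> qf Ap v = 0 ->
  exists t0 t1, (t0, t1) != (0, 0) /\ peq v (vG t0 t1).
Proof.
move=> vn Av; have [w vE] : exists w, v = G *m w.
  by exists (invmx G *m v); rewrite mulKVmx.
have wn : w != 0 by rewrite -(mulmx_unit_eq0 _ uG) -vE.
have : forall x, qf Ap (G *m x) = qf (G^T *m Ap *m G) x by move=> x; apply: qf_mulmx.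
move: (_ *m _ *m _) ApG => B [B00 B01 B02 B12 B22] ApGE.
pose e := B c3_0 c3_2 + B c3_2 c3_0.
have B11 : B c3_1 c3_1 = - e by apply/eqP; rewrite -addr_eq0 addrC -B02.
have qB x : qf B x = e * (x c3_0 ord0 * x c3_2 ord0 - x c3_1 ord0 ^+ 2).
  by rewrite qfE B00 B22 B01 B12 B11 /e; ring.
(* Otherwise C+ would vanish on the whole line z = 0, and a product of two linear forms is zero only
   if one of [pb], [qb] is. *)
have en : e != 0.
  apply/negP => /eqP e0; have Ap0 x : qf Ap x = 0.
    by rewrite -[x](mulKVmx uG) ApGE qB e0 mul0r.
  have form0 u : form_inf u = 0.
    by case: u => a b; apply: (mulfI k0); rewrite -qf_inf Ap0 mulr0.
  have f10 : pb.2 * qb.2 = 0 by have := form0 (1, 0); rewrite /form_inf /= => <-; ring.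
  have f01 : pb.1 * qb.1 = 0 by have := form0 (0, 1); rewrite /form_inf /= => <-; ring.
  have f11 : pb.2 * qb.1 + pb.1 * qb.2 = 0.
    transitivity (pb.2 * qb.2 + pb.1 * qb.1 - form_inf (1, 1)).
      by rewrite /form_inf /=; ring.
    by rewrite form0 f10 f01 addr0 subr0.
  move: pbn qbn; rewrite (surjective_pairing pb) (surjective_pairing qb) !pair_neq0.
  move/eqP: f10; rewrite mulf_eq0 => /orP[] /eqP z2;
  move/eqP: f01; rewrite mulf_eq0 => /orP[] /eqP z1;
  move: f11; rewrite z1 z2 ?mul0r ?mulr0 ?addr0 ?add0r => /eqP; rewrite ?mulf_eq0 ?eqxx //=.
  - by move=> /orP[] /eqP ->; rewrite eqxx // orbF.
  - by move=> /orP[] /eqP ->; rewrite eqxx // orbF.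
have wE : w c3_0 ord0 * w c3_2 ord0 = w c3_1 ord0 ^+ 2.
  have : qf B w = 0 by rewrite -ApGE -vE.
  by rewrite qB => /eqP; rewrite mulf_eq0 (negPf en) subr_eq0 => /eqP.
have [w00|w0n] := eqVneq (w c3_0 ord0) 0.
  have w10 : w c3_1 ord0 = 0.
    by apply/eqP; rewrite -sqrf_eq0 -wE w00 mul0r.
  exists 0, 1; split; first by rewrite pair_neq0 oner_eq0 orbT.
  rewrite vE; apply: peq_mulmx => //; split=> //.
  have w2n : w c3_2 ord0 != 0.
    by apply: contraNneq wn => w20; apply/eqP; apply: vec3P; rewrite [RHS]mxE.
  exists (w c3_2 ord0)^-1; rewrite ?invr_eq0 //.
  by apply: vec3P; rewrite !mxE /= ?w00 ?w10 ?mulVf //; ring.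
exists (w c3_0 ord0), (w c3_1 ord0); split; first by rewrite pair_neq0 w0n.
rewrite vE; apply: peq_mulmx => //; split=> //.
exists (w c3_0 ord0) => //; apply: vec3P; rewrite !mxE /= ?wE //; ring.
Qed.

Lemma inf_point_param u : u != (0, 0) -> form_inf u = 0 ->
  exists t0 t1, [/\ (t0, t1) != (0, 0), vG t0 t1 c3_2 ord0 = 0 &
    peq (gpt q tau u) (N *m nu t0 t1)].
Proof.
case: u => a b un uf.
have vn : vec3 a b 0 != 0.
  apply: contraNneq un => /colP e; have := e c3_0; have := e c3_1.
  by rewrite !mxE /= => -> ->.
have [|t0 [t1 [tn [_ [l l0 e]]]]] := conic_point_param vn.
  by rewrite qf_inf uf mulr0.
have z0 : vG t0 t1 c3_2 ord0 = 0 by rewrite e !mxE /= mulr0.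
exists t0, t1; split=> //; apply: peq_trans (line_Nnu tn z0).
by apply/gpt_peq; split=> //; exists l => //; rewrite e !mxE.
Qed.

Lemma nu2Z r t0 t1 : @nu2 K (r * t0) (r * t1) = r ^+ 2 *: nu2 t0 t1.
Proof. by apply: vec3P; rewrite !mxE /=; ring. Qed.

Lemma vGz_peq2 t0 t1 s0 s1 : peq2 (t0, t1) (s0, s1) ->
  vG t0 t1 c3_2 ord0 = 0 -> vG s0 s1 c3_2 ord0 = 0.
Proof.
by move=> [_ [r _ [-> ->]]] z0; rewrite nu2Z -scalemxAr mxE z0 mulr0.
Qed.

(** Membership in g over S provides coordinates [(a, b)] in S, and these pass to whichever of [pb],
    [qb] gives the point. *)
Lemma curve_line_point (S : pred K) u : S 1 -> on_nrc S N u -> on_g S q tau u ->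
  (peq P u /\ pt2over S pb) \/ (peq Q u /\ pt2over S qb).
Proof.
move=> S1 [t0 [t1 [_ _ tn tu]]] [a [b [Sa Sb]]]; rewrite line_gpt => abu.
have [_ [l l0 e]] := peq_trans abu (peq_sym tu).
have z0 : vG t0 t1 c3_2 ord0 = 0 by apply: Nnu_on_line tn _; rewrite e -gptZ.
have abn : (a, b) != (0, 0) by rewrite -(gpt_eq0 q tau); case: abu.
have abS : pt2over S (a, b) by split=> //; exists 1; rewrite ?oner_neq0 // !mul1r.
have over p : peq (gpt q tau p) (N *m nu t0 t1) -> pt2over S p.
  move=> pN; apply: pt2over_peq2 abS; apply/(gpt_peq q tau).
  exact: peq_trans (peq_trans pN tu) (peq_sym abu).
by have [pN|qN] := Nnu_PQ tn z0; [left|right]; split;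
  [apply: peq_trans tu|exact: over|apply: peq_trans tu|exact: over].
Qed.

(** The vector [w], the inverse of N applied to a point of g over F_{q^2}, has entries in F_{q^2}
    and is proportional to [nu t0 t1]; the quotient of its first two entries is t1 / t0. *)
Lemma S2_param r : pt2over S2 r -> form_inf r = 0 ->
  exists t0 t1, [/\ S2 t0, S2 t1, (t0, t1) != (0, 0), vG t0 t1 c3_2 ord0 = 0 &
    peq (gpt q tau r) (N *m nu t0 t1)].
Proof.
move=> [rn [l l0 [S2r1 S2r2]]] fr.
have [t0 [t1 [tn z0 rt]]] := inf_point_param rn fr.
have lt : peq (gpt q tau (l * r.1, l * r.2)) (N *m nu t0 t1).
  by apply: peq_trans rt; rewrite gptZ; apply/peq_sym/peqZ; rewrite ?gpt_eq0.
have [_ [e e0 ltE]] := peq_sym lt.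
have S2tau : S2 (tau ^+ q) by rewrite sigmaE; apply/S2P; rewrite sigma2_tau.
pose w := e *: nu t0 t1; have wE : w = invmx N *m gpt q tau (l * r.1, l * r.2).
  by rewrite ltE -scalemxAr mulKmx.
have sNi i j : sigma (invmx N i j) = invmx N i j.
  have e1 : map_mx sigma N = N by apply/matrixP => i' j'; rewrite mxE; apply/(FsubP sigmaE)/sN.
  by rewrite -[in RHS]e1 -map_invmx mxE.
have sw i : sigma (sigma (w i ord0)) = w i ord0.
  rewrite wE; apply: (@sigma_mulmx _ _ _ _ (sigma \o sigma)%FUN) => {}i j /=.
    by rewrite !sNi.
  rewrite ord1 gptE; move: i; apply: ord5P; rewrite mxE /=; apply/S2P.
  - exact: S2M.
  - exact: S2N.
  - exact: S2M.
  - exact: S2N.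
  - by apply/S2P; rewrite !rmorph0.
have [t00|t0n] := eqVneq t0 0.
  have t1n : t1 != 0 by rewrite t00 pair_neq0 eqxx in tn.
  have tp : peq2 (t0, t1) (0, 1).
    by apply: peq2_cross => //=; rewrite ?pair_neq0 ?oner_eq0 ?orbT // t00 mul0r mulr0.
  exists 0, 1; split.
  - by apply/S2P; rewrite !rmorph0.
  - by apply/S2P; rewrite !rmorph1.
  - exact: peq2_neq0 tp.
  - exact: vGz_peq2 tp z0.
  - by apply: peq_trans rt _; apply: peq_mulmx => //; apply: nu_peq2.
have tp : peq2 (t0, t1) (1, t1 / t0).
  by apply: peq2_cross => //=; rewrite ?pair_neq0 ?oner_eq0 // mulr1 mulrC divfK.
exists 1, (t1 / t0); split.
- by apply/S2P; rewrite !rmorph1.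
- have -> : t1 / t0 = w c5_1 ord0 / w c5_0 ord0.
    by rewrite !mxE /=; field; rewrite t0n e0.
  by apply: S2M; [|apply: S2V]; apply/S2P; apply: sw.
- exact: peq2_neq0 tp.
- exact: vGz_peq2 tp z0.
- by apply: peq_trans rt _; apply: peq_mulmx => //; apply: nu_peq2.
Qed.

Lemma form_inf_pb : form_inf pb = 0.
Proof. by rewrite /form_inf [pb.2 * _]mulrC subrr mul0r. Qed.

Lemma form_inf_qb : form_inf qb = 0.
Proof. by rewrite /form_inf [qb.2 * _]mulrC subrr mulr0. Qed.

Lemma meet_over_K u : (on_nrc predT N u /\ on_g predT q tau u) <-> (peq P u \/ peq Q u).
Proof.
split=> [[uC ug]|PQu]; first by have [[]|[]] := curve_line_point isT uC ug; [left|right].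
have aux p : p != (0, 0) -> form_inf p = 0 -> peq (gpt q tau p) u ->
    on_nrc predT N u /\ on_g predT q tau u.
  move=> pn fp pu; have [t0 [t1 [tn _ pt]]] := inf_point_param pn fp; split.
    by exists t0, t1; split=> //; apply: peq_trans (peq_sym pt) pu.
  by exists p.1, p.2; rewrite line_gpt -surjective_pairing.
by case: PQu; apply: aux; rewrite ?form_inf_pb ?form_inf_qb.
Qed.

Lemma meet_over_S2 u : (on_nrc S2 N u /\ on_g S2 q tau u) <->
  (peq P u /\ pt2over S2 pb) \/ (peq Q u /\ pt2over S2 qb).
Proof.
have S21 : S2 1 by apply/S2P; rewrite !rmorph1.
split=> [[]|PQu]; first exact: curve_line_point.
have aux p : pt2over S2 p -> form_inf p = 0 -> peq (gpt q tau p) u ->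
    on_nrc S2 N u /\ on_g S2 q tau u.
  move=> pS fp pu; have [t0 [t1 [S0 S1 tn _ pt]]] := S2_param pS fp; split.
    by exists t0, t1; split=> //; apply: peq_trans (peq_sym pt) pu.
  case: pS => pn [l l0 [Sl1 Sl2]]; exists (l * p.1), (l * p.2); split=> //.
  by rewrite line_gpt gptZ; apply: peq_trans pu; apply/peq_sym/peqZ; rewrite ?gpt_eq0.
case: PQu => [[pu pS]|[qu qS]]; first exact: aux pS form_inf_pb pu.
exact: aux qS form_inf_qb qu.
Qed.

(** * Conjugation over F_{q^2} on the line at infinity *)

Definition conj2 (u : K * K) := (sigma (sigma u.1), sigma (sigma u.2)).

Lemma conj2_neq0 u : u != (0, 0) -> conj2 u != (0, 0).
Proof. by case: u => a b; rewrite /conj2 !pair_neq0 /= !fmorph_eq0. Qed.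

Lemma form_inf_conj2 u : form_inf u = 0 -> form_inf (conj2 u) = 0.
Proof.
case: u => a b fu; have sA i j : sigma (sigma (Ap i j)) = Ap i j by apply/S2P/sAp.
apply: (mulfI k0); rewrite mulr0 -qf_inf.
transitivity (sigma (sigma (qf Ap (vec3 a b 0)))); last by rewrite qf_inf fu mulr0 !rmorph0.
by rewrite !qfE !mxE /= !(rmorphD, rmorphM, rmorphXn, rmorph0) /= !sA.
Qed.

(** Scaling a nonzero coordinate to 1 turns invariance up to a factor into invariance of the other
    coordinate. *)
Lemma conj2_fixed u : peq2 u (conj2 u) -> pt2over S2 u.
Proof.
case: u => a b [un [l l0 [ea eb]]]; split=> //=.
have [a0|an] := eqVneq a 0.
  have bn : b != 0 by rewrite a0 pair_neq0 eqxx in un.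
  exists b^-1; rewrite ?invr_eq0 // a0 mulr0 mulVf //.
  by split; apply/S2P; rewrite ?rmorph0 ?rmorph1.
exists a^-1; rewrite ?invr_eq0 // mulVf //; split; first by apply/S2P; rewrite !rmorph1.
by apply/S2P; rewrite !rmorphM /= !fmorphV ea eb /=; field; rewrite an l0.
Qed.

(** The conjugate of a double root is again a root, hence the same point. *)
Lemma peq2_pt2over : peq2 pb qb -> pt2over S2 pb.
Proof.
move=> pq; apply: conj2_fixed.
have [//|qp] := form_inf_root (conj2_neq0 pbn) (form_inf_conj2 form_inf_pb).
exact: peq2_trans qp.
Qed.

(** Conjugation either fixes r or sends it to p; in the second case r is the conjugate of p, and
    conjugates of points over F_{q^2} are over F_{q^2}. *)
Lemma pt2over_other p r : p != (0, 0) -> r != (0, 0) -> form_inf r = 0 ->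
  (forall u, u != (0, 0) -> form_inf u = 0 -> peq2 p u \/ peq2 r u) ->
  pt2over S2 p -> pt2over S2 r.
Proof.
move=> pn rn fr roots pS.
have [pr|] := roots _ (conj2_neq0 rn) (form_inf_conj2 fr); last exact: conj2_fixed.
have sp : peq2 r (conj2 p).
  case: pr => _ [m m0]; case: r rn {fr roots} => a b rn [ea eb].
  split=> //; exists (sigma (sigma m))^-1; rewrite ?invr_eq0 ?fmorph_eq0 //.
  by rewrite /conj2 -[a]sigma4 -[b]sigma4 ea eb !rmorphM /= !mulKf ?fmorph_eq0.
apply: pt2over_peq2 sp _; case: pS => _ [l l0 [S2p1 S2p2]].
split; first exact: conj2_neq0.
exists (sigma (sigma l)); rewrite ?fmorph_eq0 //=.
rewrite -!rmorphM /=.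
by split; apply/S2P; [move/S2P: S2p1|move/S2P: S2p2] => e; rewrite !e.
Qed.


Lemma pt2over_pb_qb : pt2over S2 pb <-> pt2over S2 qb.
Proof.
split; [apply: pt2over_other form_inf_qb _ | apply: pt2over_other form_inf_pb _] => //.
  exact: form_inf_root.
by move=> u un fu; have [] := form_inf_root un fu; [right|left].
Qed.

(** * Hyperplanes through the transversal and intersection multiplicity *)

Lemma mul_conj_products (m : 'rV[K]_5) : m ord0 c5_0 = 0 -> m ord0 c5_2 = 0 ->
  m *m E *m N = conv (c *: (\row_j [:: m ord0 c5_1; m ord0 c5_3; m ord0 c5_4]`_j *m Gs))
                     (row c3_2 G).
Proof.
move=> m0 m2; rewrite -mulmxA NE -scalemxAr; apply: rvec5P.
all: by rewrite !mxE sum5E m0 m2 ?mxE /= ?mxE ?sum3E ?mxE /=; ring.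
Qed.

(** Vanishing on [A0] and [A1] removes the coefficients of x z' and y z'; the remaining terms in x'
    z, y' z and z z' share the factor z. *)
Lemma line_hyperplane (l : 'rV[K]_5) : l *m A0 q tau = 0 -> l *m A1 q tau = 0 ->
  exists a, bform l N = quadratic a * quadratic (row c3_2 G).
Proof.
move=> l0 l1; pose m := l *m invmx E; have lE : l = m *m E by rewrite mulmxKV.
have dn : sigma tau - tau != 0 by rewrite subr_eq0.
have mg p : l *m gpt q tau p = 0 -> m ord0 c5_0 * p.1 + m ord0 c5_2 * p.2 = 0.
  rewrite lE -mulmxA EgptE -scalemxAr => /matrixP /(_ ord0 ord0).
  rewrite !mxE sum5E !mxE /= !mulr0 !addr0 => /eqP.
  by rewrite mulf_eq0 (negPf dn) => /eqP.
have m0 : m ord0 c5_0 = 0.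
  by rewrite -[RHS](mg (1, 0)) /= ?mulr1 ?mulr0 ?addr0 // /gpt /= scale1r scale0r addr0.
have m2 : m ord0 c5_2 = 0.
  by rewrite -[RHS](mg (0, 1)) /= ?mulr1 ?mulr0 ?add0r // /gpt /= scale1r scale0r add0r.
have := mul_conj_products m0 m2; rewrite -lE; set a := c *: _ => lN.
by exists a; rewrite -quartic_conv -lN.
Qed.

(** The forms x', y', z' are a basis of the binary quadratic forms since [Gs] is invertible, so the
    cofactor of z can be prescribed. *)
Lemma hyperplane_of_quadratic (a : 'rV[K]_3) :
  (forall j, sigma (sigma (a ord0 j)) = a ord0 j) ->
  exists l : 'rV[K]_5, [/\ rover S2 l, l *m A0 q tau = 0, l *m A1 q tau = 0 &
    bform l N = (c%:P * quadratic a) * quadratic (row c3_2 G)].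
Proof.
move=> sa; pose b := a *m invmx Gs.
pose m : 'rV[K]_5 := \row_j [:: 0; b ord0 c3_0; 0; b ord0 c3_1; b ord0 c3_2]`_j.
have mE : \row_j [:: m ord0 c5_1; m ord0 c5_3; m ord0 c5_4]`_j = b.
  by apply/rowP; apply: ord3P; rewrite !mxE.
have sb i j : sigma (sigma (b i j)) = b i j.
  apply: (@sigma_mulmx _ _ _ _ (sigma \o sigma)%FUN) => {}i {}j /=; first by rewrite ord1.
  have : map_mx sigma (map_mx sigma Gs) = Gs by apply/matrixP => i' j'; rewrite !mxE sG.
  by move=> e; rewrite -[in RHS]e -!map_invmx !mxE.
have dn : sigma tau - tau != 0 by rewrite subr_eq0.
have mg p : (m *m E) *m gpt q tau p = 0.
  rewrite -mulmxA EgptE; apply/rowP => j; rewrite ord1 row5E !mxE /=; ring.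
exists (m *m E); split.
- move=> j; apply/S2P; apply: (@sigma_mulmx _ _ _ _ (sigma \o sigma)%FUN) => {}i {}j /=.
    by move: j; apply: ord5P; rewrite mxE /= ?rmorph0 ?sb.
  by move: i j; apply: ord5P; apply: ord5P; rewrite mxE /= ?rmorph0 ?rmorph1 ?sigma2_tau.
- by rewrite -[RHS](mg (1, 0)) /gpt /= scale1r scale0r addr0.
- by rewrite -[RHS](mg (0, 1)) /gpt /= scale1r scale0r add0r.
rewrite -[LHS]/(quartic (m *m E *m N)) mul_conj_products; try by rewrite mxE.
rewrite mE quartic_conv mulmxKV //.
by rewrite /quadratic !mxE !polyCM; ring.
Qed.

Lemma vGzE t0 t1 : vG t0 t1 c3_2 ord0 =
  G c3_2 c3_0 * t0 ^+ 2 + G c3_2 c3_1 * (t0 * t1) + G c3_2 c3_2 * t1 ^+ 2.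
Proof. by rewrite mxE sum3E !mxE. Qed.

(** All roots of z map to the single point P and the curve is injective, so z has one root,
    necessarily double. A root at (1 : 0) shows as a constant dehomogenisation. *)
Lemma tangent_quadratic s0 s1 : peq2 pb qb -> (s0, s1) != (0, 0) ->
  vG s0 s1 c3_2 ord0 = 0 ->
  if s1 == 0 then exists2 e, e != 0 & quadratic (row c3_2 G) = e%:P
  else exists2 e, e != 0 & quadratic (row c3_2 G) = e%:P * ('X - (s0 / s1)%:P) ^+ 2.
Proof.
move=> pq sn zs; have root r0 r1 : (r0, r1) != (0, 0) -> vG r0 r1 c3_2 ord0 = 0 ->
    r0 * s1 = r1 * s0.
  have PN t0 t1 : (t0, t1) != (0, 0) -> vG t0 t1 c3_2 ord0 = 0 -> peq P (N *m nu t0 t1).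
    move=> tn /(Nnu_PQ tn) [//|]; apply: peq_trans; exact/gpt_peq.
  move=> rn zr; have /(peq_mulmxI uN)/nu_peqI[_ [l _ [-> ->]]] :=
    peq_trans (peq_sym (PN _ _ rn zr)) (PN _ _ sn zs).
  by rewrite /=; ring.
rewrite vGzE in zs; rewrite /quadratic !mxE.
have root' r0 r1 : (r0, r1) != (0, 0) -> G c3_2 c3_0 * r0 ^+ 2 + G c3_2 c3_1 * (r0 * r1)
  + G c3_2 c3_2 * r1 ^+ 2 = 0 -> r0 * s1 = r1 * s0 by rewrite -vGzE; apply: root.
move: root' zs {root}; move: (G c3_2 c3_0) (G c3_2 c3_1) (G c3_2 c3_2) => z0 z1 z2 root zs.
have [s10|s1n] := eqVneq s1 0.
  have s0n : s0 != 0 by rewrite s10 pair_neq0 eqxx orbF in sn.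
  have z00 : z0 = 0.
    apply: (mulIf (expf_neq0 2 s0n)); rewrite mul0r -zs s10; ring.
  (* Otherwise (- z2 : z1) would be a second root. *)
  have z10 : z1 = 0.
    apply/eqP/negP => /negP z1n; have /root : (- z2, z1) != (0, 0).
      by rewrite pair_neq0 z1n orbT.
    rewrite z00 s10 mulr0 => e; have /eqP := e ltac:(ring).
    by rewrite eq_sym mulf_eq0 (negPf z1n) (negPf s0n).
  exists z2; last by rewrite z00 z10 !mul0r !add0r.
  apply/negP => /eqP z20; have /root : ((0, 1) : K * K) != (0, 0).
    by rewrite pair_neq0 oner_eq0 orbT.
  rewrite z00 z10 z20 s10 => e; have /eqP := e ltac:(ring).
  by rewrite mulr0 mul1r eq_sym (negPf s0n).
pose a := s0 / s1; have as1 : s0 = a * s1 by rewrite divfK.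
have za : z0 * a ^+ 2 + z1 * a + z2 = 0.
  by apply: (mulIf (expf_neq0 2 s1n)); rewrite mul0r -zs as1; ring.
have z0n : z0 != 0.
  apply/negP => /eqP z00; have /root : ((1, 0) : K * K) != (0, 0) by rewrite pair_neq0 oner_eq0.
  by rewrite z00 => e; have /eqP := e ltac:(ring); rewrite mul1r mul0r (negPf s1n).
have z2E : z2 = - (z0 * a ^+ 2 + z1 * a) by apply/eqP; rewrite -addr_eq0 addrC za.
have z1E : z1 = - (2 * z0 * a).
  (* The other root, by Vieta; uniqueness gives b = a. *)
  pose b := - z1 / z0 - a.
  have /root : ((b, 1) : K * K) != (0, 0) by rewrite pair_neq0 oner_eq0 orbT.
  have e : z0 * b ^+ 2 + z1 * (b * 1) + z2 * 1 ^+ 2 = 0 by rewrite z2E /b; field.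
  move=> /(_ e) bs; have ba : b = a by apply: (mulIf s1n); rewrite bs as1 mul1r.
  have -> : z1 = - (z0 * (b + a)) by rewrite /b; field.
  by rewrite ba; ring.
exists z0 => //; rewrite -/a z2E z1E !(polyCN, polyCD, polyCM, polyC_exp, polyC_natr); ring.
Qed.

Lemma tangent_imult s0 s1 : peq2 pb qb -> (s0, s1) != (0, 0) ->
  vG s0 s1 c3_2 ord0 = 0 -> imult_is q tau N s0 s1 2.
Proof.
move=> pq sn zs; have := tangent_quadratic pq sn zs; have [s10|s1n] := eqVneq s1 0.
  move=> [e e0 zE]; split.
    (* The cofactor t0^2 does not vanish at (1 : 0); it gives degree 2, hence multiplicity 4 - 2. *)
    have [|l [lS l0 l1 lN]] := @hyperplane_of_quadratic (\row_j [:: 1; 0; 0]`_j).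
      by apply: ord3P; rewrite mxE /= ?rmorph0 ?rmorph1.
    exists l; rewrite /bmult s10 eqxx.
    have fE : bform l N = (c * e) *: 'X^2.
      by rewrite lN zE /quadratic !mxE /= -mul_polyC polyCM !polyC0 polyC1; ring.
    have ce : c * e != 0 by rewrite mulf_neq0.
    by rewrite fE size_scale // size_polyXn scaler_eq0 (negPf ce) -size_poly_eq0 size_polyXn.
  move=> l _ l0 l1 fn; have [a fE] := line_hyperplane l0 l1.
  (* Any cofactor has degree at most 2, so the multiplicity at infinity is at least 2. *)
  rewrite /bmult s10 eqxx fE zE mulrC mul_polyC size_scale //.
  by move: (size_quadratic a); case: (size _) => [|[|[|[|]]]].
(* The cofactor t1^2 dehomogenises to 1, so only the double root of z counts. *)
move=> [e e0 zE]; have [|l [lS l0 l1 lN]] := @hyperplane_of_quadratic (\row_j [:: 0; 0; 1]`_j).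
  by apply: ord3P; rewrite mxE /= ?rmorph0 ?rmorph1.
have mup2 r : r != 0 -> mup (s0 / s1) (r * (e%:P * ('X - (s0 / s1)%:P) ^+ 2)) =
    (mup (s0 / s1) r + 2)%N.
  move=> rn; have Xn : ('X - (s0 / s1)%:P) ^+ 2 != 0 by rewrite expf_neq0 // polyXsubC_eq0.
  have en : e%:P != 0 by rewrite polyC_eq0.
  rewrite (mupM _ rn (mulf_neq0 en Xn)) mupMr ?rootC //; congr (_ + _)%N.
  by rewrite mup_XsubCX eqxx.
split.
  have fE : bform l N = c%:P * (e%:P * ('X - (s0 / s1)%:P) ^+ 2).
    by rewrite lN zE /quadratic !mxE /= !polyC0 polyC1; ring.
  have cn : c%:P != 0 by rewrite polyC_eq0.
  exists l; rewrite /bmult (negPf s1n) fE mup2 // mupNroot ?rootC //.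
  by rewrite !mulf_neq0 ?polyC_eq0 ?polyXsubC_eq0.
move=> l' _ l0' l1' fn; have [a fE] := line_hyperplane l0' l1'.
rewrite /bmult (negPf s1n) fE zE mup2 ?leq_addl //.
by apply: contraNneq fn => a0; rewrite fE a0 mul0r.
Qed.

End Transversal.

(** * The tangent, secant and conjugate cases *)

Theorem theorem5p10 (q : nat) (K : finFieldType) (tau : K)
    (M A Ap : 'M[K]_3) (N : 'M[K]_5) (pb qb : K * K) :
  (7 < q)%N -> #|K| = (q ^ 4)%N ->
  (* tau is a primitive element of F_{q^2} *)
  (q ^ 2 - 1)%N.-primitive_root tau ->
  (* B = M(PG(2,q)) is a Baer subplane of PG(2,q^2) *)
  mover (Fsub (q ^ 2)) M -> M \in unitmx ->
  (* B is tangent to l_oo : z = 0 *)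
  (exists v0, [/\ in_B q M v0, v0 c3_2 ord0 = 0 &
     forall v, in_B q M v -> v c3_2 ord0 = 0 -> peq v0 v]) ->
  (* C is an F_q-conic of B *)
  mover (Fsub q) A -> qdisc A != 0 ->
  (* the point B /\ l_oo is not on C *)
  (forall v, in_B q M v -> v c3_2 ord0 = 0 -> ~ in_C q M A v) ->
  (* C+ : a non-degenerate conic of PG(2,q^2) containing C *)
  mover (Fsub (q ^ 2)) Ap -> qdisc Ap != 0 ->
  (forall v, in_C q M A v -> qf Ap v = 0) ->
  (* C+ meets l_oo (extended to PG(2,q^4)) in Pbar = (pb,0), Qbar = (qb,0),
     counted with multiplicity: C+ |_{z=0} = c (pb.2 x - pb.1 y)(qb.2 x - qb.1 y) *)
  pb != (0, 0) -> qb != (0, 0) ->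
  (exists2 c : K, c != 0 &
     [/\ Ap c3_0 c3_0 = c * pb.2 * qb.2,
         Ap c3_0 c3_1 + Ap c3_1 c3_0 = - (c * (pb.2 * qb.1 + pb.1 * qb.2)) &
         Ap c3_1 c3_1 = c * pb.1 * qb.1]) ->
  (* [C] = { N nu(t) : t in PG(1,q) }, a 4-dim normal rational curve of PG(4,q) *)
  mover (Fsub q) N -> N \in unitmx ->
  (forall u, in_bbC q tau M A u <-> on_nrc (Fsub q) N u) ->
  let P := gpt q tau pb in
  let Q := gpt q tau qb in
  [/\
   (* (1) *)
   (peq2 pb qb <->
      (forall u, (on_nrc (Fsub (q ^ 2)) N u /\ on_g (Fsub (q ^ 2)) q tau u) <-> peq P u)
      /\ (exists t0 t1, [/\ Fsub (q ^ 2) t0, Fsub (q ^ 2) t1, (t0, t1) != (0, 0),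
                            peq P (N *m nu t0 t1) & imult_is q tau N t0 t1 2])),
   (* (2) *)
   ([/\ ~ peq2 pb qb, pt2over (Fsub (q ^ 2)) pb & pt2over (Fsub (q ^ 2)) qb] <->
      ~ peq P Q /\
      (forall u, (on_nrc (Fsub (q ^ 2)) N u /\ on_g (Fsub (q ^ 2)) q tau u) <->
                 (peq P u \/ peq Q u))) &
   (* (3) *)
   ((~ pt2over (Fsub (q ^ 2)) pb /\ ~ pt2over (Fsub (q ^ 2)) qb) <->
      [/\ ~ peq P Q,
          (forall u, ~ (on_nrc (Fsub (q ^ 2)) N u /\ on_g (Fsub (q ^ 2)) q tau u)) &
          (forall u, (on_nrc predT N u /\ on_g predT q tau u) <->
                     (peq P u \/ peq Q u))])].
Proof.
move=> q7 cardK tauP sM uM _ sA A0 affC sAp _ ApC pbn qbn [k k0 [Ap00 Ap01 Ap11]].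
move=> sN uN curveN P Q.
have q0 : (0 < q)%N by apply: leq_trans q7.
have [sigma sigmaE] := power_map_rmorphism q0 cardK.
have sigma4 x : sigma (sigma (sigma (sigma x))) = x.
  by rewrite -!sigmaE -!exprM -[RHS]expf_card cardK !expnS muln1 !mulnA.
have st := sigma_tau_neq q7 sigmaE tauP; have s2t := sigma2_tau q7 sigmaE tauP.
have [G [c [uG c0 sG NE ApG]]] :=
  curve_parametrization q7 sigmaE tauP sM uM A0 sA affC ApC uN curveN.
have onK := meet_over_K sigmaE st pbn qbn k0 Ap00 Ap01 Ap11 uN uG c0 NE ApG.
have onS2 := meet_over_S2 sigmaE st s2t pbn qbn k0 Ap00 Ap01 Ap11 sN uN uG c0 NE ApG.
have pq_over := pt2over_pb_qb sigmaE sigma4 sAp pbn qbn k0 Ap00 Ap01 Ap11.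
have eq_over := peq2_pt2over sigmaE sAp pbn qbn k0 Ap00 Ap01 Ap11.
have PQE : peq P Q <-> peq2 pb qb by apply: gpt_peq.
have PP : peq P P by apply: peq_refl; rewrite gpt_eq0.
have QQ : peq Q Q by apply: peq_refl; rewrite gpt_eq0.
(* One common point over F_{q^2} already puts both [pb] and [qb] over F_{q^2}. *)
have P_over u : on_nrc (Fsub (q ^ 2)) N u /\ on_g (Fsub (q ^ 2)) q tau u ->
    pt2over (Fsub (q ^ 2)) pb.
  by move=> /onS2[[_ //]|[_ /pq_over]].
split; split.
- move=> pq; have pS := eq_over pq; split.
    move=> u; rewrite onS2; split=> [[[//]|[Qu _]]|Pu]; last by left.
    by apply: peq_trans Qu; apply/PQE.
  have [t0 [t1 [S0 S1 tn z0 Pt]]] := S2_param sigmaE st s2t pbn qbn k0 Ap00 Ap01 Ap11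
    sN uN uG NE ApG pS (form_inf_pb pb qb).
  exists t0, t1; split=> //.
  exact (tangent_imult sigmaE st s2t pbn qbn k0 Ap00 Ap01 Ap11 uN uG c0 sG NE ApG pq tn z0).
(* Since P is a common point, [qb] is over F_{q^2}; then Q is a common point too, and equals P. *)
- move=> [meet _]; apply/PQE/meet/onS2; right; split=> //.
  by apply/pq_over; apply: (P_over P); apply/meet.
- move=> [npq pS qS]; split; first by move/PQE.
  by move=> u; rewrite onS2; split=> [[[Pu _]|[Qu _]]|[Pu|Qu]]; [left|right|left|right].
- move=> [nPQ meet]; have pS : pt2over (Fsub (q ^ 2)) pb.
    by apply: (P_over P); apply/meet; left.
  by split=> //; [move/PQE|apply/pq_over].
(* P and Q differ because a double root would be over F_{q^2}. *)
- move=> [npS _]; split=> //; first by move/PQE/eq_over.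
  by move=> u /onS2[[_ /npS]|[_ /pq_over/npS]].
- move=> [_ none _]; have npS : ~ pt2over (Fsub (q ^ 2)) pb.
    by move=> pS; case: (none (gpt q tau pb)); apply/onS2; left.
  by split=> // /pq_over.
Qed.
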